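(* Let $M\in\mathcal{W}_1(d)$ and let $\mathbb{F}$ be a field. Then: (a) If $d\neq 3$, then $M$ is $\mathbb{F}$-tight if and only if $M$ is $2$-neighbourly and $\mathbb{F}$-orientable. (b) If $d=3$, then $M$ is $\mathbb{F}$-tight if and only if $M$ is $2$-neighbourly, $\mathbb{F}$-orientable, and satisfies $\beta_1(M;\mathbb{F})=(n-4)(n-5)/20$, where $n=f_0(M)$ is the number of vertices of $M$.
   Context: All simplicial complexes are finite and abstract, with the empty set as a face. For a finite set $\alpha$, $\overline{\alpha}$ is the complex of all subsets of $\alpha$ and $\partial\alpha$ the complex of all proper subsets. The standard sphere $S^d_{d+2}$ is $\partial\alpha$ with $\#\alpha=d+2$. Complexes are identified up to isomorphism. A $d$-dimensional complex is a $1$-stellated sphere if it is obtained from $S^d_{d+2}$ by a finite sequence of bistellar moves of index $0$; a bistellar move of index $0$ replaces a facet $\alpha$ ($\#\alpha=d+1$) by the cone $x\ast\partial\alpha$ over its boundary from a new vertex $x$. The link of a vertex $x$ in $X$ is $\{\alpha\in X: x\notin\alpha,\ \alpha\sqcup\{x\}\in X\}$. For $d\ge1$, $\mathcal{W}_1(d)$ is the class of connected $d$-dimensional simplicial complexes all of whose vertex links are $1$-stellated $(d-1)$-spheres (such complexes triangulate closed manifolds). $X$ is $2$-neighbourly if any two vertices form an edge. For a field $\mathbb{F}$, a $d$-dimensional complex $X$ is $\mathbb{F}$-tight if it is connected and, for every induced subcomplex $Y$ of $X$ (all faces of $X$ contained in some vertex subset) and every $0\le j\le d$, the morphism $H_j(Y;\mathbb{F})\to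 H_j(X;\mathbb{F})$ induced by inclusion is injective. $\beta_1(M;\mathbb{F})=\dim_{\mathbb{F}}H_1(M;\mathbb{F})$. *)

(* Defs.v *)
From HB Require Import structures.
From mathcomp Require Import all_boot all_order all_algebra.

Set Implicit Arguments.
Unset Strict Implicit.
Unset Printing Implicit Defensive.

Import GRing.Theory.
Local Open Scope ring_scope.

(* A complex is the set of its faces, on some of the points of T: the vertices
   are the x with [set x] \in K, and T may contain further points. *)
Section Complexes.

Variable T : finType.
Implicit Types (K L M X Y : {set {set T}}) (a b A : {set T}) (x y : T).

Definition simplicial_complex K : Prop :=
  set0 \in K /\ forall a b, a \in K -> b \subset a -> b \in K.

Definition vertices K : {set T} := [set x | [set x] \in K].

Definition dim_complex (d : nat) K : Prop :=
  simplicial_complex K /\ (\max_(a in K) #|a|)%N = d.+1.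

Definition facet K a : bool := maxset (fun b => b \in K) a.

Definition bd_simplex a : {set {set T}} := [set b : {set T} | b \proper a].

(* For x not a vertex of L. *)
Definition cone x L : {set {set T}} := L :|: [set x |: b | b : {set T} in L].

Definition link x X : {set {set T}} :=
  [set a : {set T} | [&& a \in X, x \notin a & x |: a \in X]].

Definition induced X A : {set {set T}} := [set a : {set T} in X | a \subset A].

Definition connected X : Prop :=
  forall x y, x \in vertices X -> y \in vertices X ->
    connect (fun u v => [set u; v] \in X) x y.

Definition two_neighbourly X : Prop :=
  forall x y, x \in vertices X -> y \in vertices X -> x != y ->
    [set x; y] \in X.

(* The only face removed by a move is [a] itself (its proper faces are in
   [bd_simplex a]).  For d >= 1 a move therefore never loses a vertex, and a
   sequence of moves leading to K takes place on the vertices of K; for d = 0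
   all the complexes involved are pairs of points.  Hence staying inside T
   yields all the complexes on T that are isomorphic to a 1-stellated sphere. *)
Inductive stellated1_sphere (d : nat) : {set {set T}} -> Prop :=
| stellated1_standard a :
    #|a| = d.+2 -> stellated1_sphere d (bd_simplex a)
| stellated1_move K a x :
    stellated1_sphere d K ->
    facet K a -> #|a| = d.+1 -> x \notin vertices K ->
    stellated1_sphere d ((K :\ a) :|: cone x (bd_simplex a)).

Definition W1 (d : nat) M : Prop :=
  [/\ (0 < d)%N, dim_complex d M, connected M
    & forall x, x \in vertices M -> stellated1_sphere d.-1 (link x M)].

End Complexes.

Section Homology.

Variables (F : fieldType) (T : finType).
Implicit Types (K X Y : {set {set T}}) (a b A : {set T}) (x y : T).

(* Simplicial chains of all degrees; the coefficient at a refers to the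
   orientation of a given by the enumeration order of T. *)
Notation chain := {ffun {set T} -> F^o}.

Definition inc_sign x b : F :=
  (-1) ^+ #|[set y in b | (enum_rank y < enum_rank x)%N]|.

(* The coefficient at b of the boundary of a simplex x |: b is (-1) ^+ i, where
   i is the position of x in x |: b.  The coefficient at the empty face is
   dropped: homology is not reduced. *)
Definition boundary (c : chain) : chain :=
  [ffun b => if b == set0 then 0
             else \sum_(x | x \notin b) inc_sign x b * c (x |: b)].

Definition elementary (a : {set T}) : chain := [ffun b => (b == a)%:R].

Definition chains K (j : nat) : {vspace chain} :=
  <<[seq elementary a | a <- enum K & #|a| == j.+1]>>%VS.

Definition cycles K j : {vspace chain} :=
  (chains K j :&: lker (linfun boundary))%VS.

Definition boundaries K j : {vspace chain} :=
  (linfun boundary @: chains K j.+1)%VS.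

Lemma boundary_is_linear : linear boundary.
Proof.
move=> k c c'; apply/ffunP=> b; rewrite !ffunE.
case: ifP => _; first by rewrite scaler0 addr0.
rewrite scaler_sumr -big_split /=; apply: eq_bigr => x _.
by rewrite !ffunE mulrDr /GRing.scale /= mulrCA.
Qed.

HB.instance Definition _ :=
  GRing.isLinear.Build F chain chain *:%R boundary boundary_is_linear.

Lemma boundaryK c : boundary (boundary c) = 0.
Proof.
apply/ffunP=> b; rewrite !ffunE; case: ifP => // /negbT b0.
pose r x := enum_rank x : nat.
have sgU x y : x \notin b ->
  inc_sign y (x |: b) = (-1) ^+ (r x < r y)%N * inc_sign y b.
  move=> xb; rewrite /inc_sign -exprD; congr (_ ^+ _).
  have [xy|yx] := boolP (r x < r y)%N.
    rewrite (_ : [set z in x |: b | _] =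
                 x |: [set z in b | (enum_rank z < enum_rank y)%N]).
      by rewrite cardsU1 !inE (negbTE xb).
    by apply/setP=> z; rewrite !inE; case: eqP => // ->; rewrite -/(r x) xy.
  apply: eq_card => z; rewrite !inE; case: eqP => // ->.
  by rewrite -/(r x) -/(r y) (negbTE yx) ?andbF.
pose f x y := inc_sign x b * (inc_sign y (x |: b) * c (y |: (x |: b))).
transitivity (\sum_(x | x \notin b) \sum_(y | (y \notin b) && (y != x)) f x y).
  apply: eq_bigr => x xb; rewrite ffunE ifF; last first.
    by apply/negbTE/set0Pn; exists x; rewrite !inE eqxx.
  rewrite mulr_sumr. apply: eq_bigl => y.
  by rewrite !inE negb_or andbC.
have anti x y : x \notin b -> y \notin b -> y != x -> (r x < r y)%N ->
  f x y = - f y x.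
  move=> xb yb yx xy; rewrite /f (sgU x y xb) (sgU y x yb) xy.
  rewrite [(r y < r x)%N]ltnNge (ltnW xy) /= expr1 expr0 mul1r mulN1r.
  by rewrite mulNr mulrN setUCA !mulrA (mulrC (inc_sign x b)).
pose P x y := [&& x \notin b, y \notin b & (r x < r y)%N].
have -> : \sum_(x | x \notin b) \sum_(y | (y \notin b) && (y != x)) f x y
  = \sum_x \sum_(y | P x y) f x y + \sum_x \sum_(y | P y x) f x y.
  rewrite -big_split [RHS](bigID (fun x => x \notin b)) /=.
  rewrite [X in _ = _ + X]big1 ?addr0; last first.
    by move=> x /negbNE xb; rewrite !big_pred0 ?addr0 // => y; rewrite /P xb ?andbF.
  apply: eq_bigr => x xb.
  rewrite (bigID (fun y => (r x < r y)%N)) /=; congr (_ + _); apply: eq_bigl => y.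
    rewrite /P xb /= -andbA; case: eqP => [->|] //=.
    by rewrite ltnn !andbF.
  rewrite /P xb /= -andbA; congr (_ && _).
  rewrite -leqNgt [RHS]ltn_neqAle; congr (_ && _).
  by rewrite (inj_eq (inj_comp val_inj enum_rank_inj)).
rewrite [X in _ + X](exchange_big_dep predT) //= -big_split big1 //= => x _.
rewrite -big_split big1 //= => y /and3P[xb yb xy].
rewrite anti ?addNr //; apply: contraTneq xy => ->; by rewrite ltnn.
Qed.

Lemma memv_chains K j c :
  c \in chains K j <-> forall a, c a != 0 -> a \in K /\ #|a| = j.+1.
Proof.
split=> [/(@coord_span _ _ _ (in_tuple _)) -> a|cK].
  rewrite sum_ffunE => nz.
  suff /andP[-> /eqP] : (a \in K) && (#|a| == j.+1) by [].
  apply: contraNT nz => aK; rewrite big1 // => i _; rewrite ffunE /=.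
  have /mapP[a' + ->] := mem_nth 0 (ltn_ord i).
  rewrite mem_filter mem_enum => /andP[a'j a'K].
  rewrite ffunE; case: eqP => [aa'|_]; last by rewrite scaler0.
  by rewrite aa' a'K a'j in aK.
have -> : c = \sum_a c a *: elementary a.
  apply/ffunP=> a; rewrite sum_ffunE (bigD1 a) //= big1 => [|b ba].
    by rewrite !ffunE eqxx addr0 [RHS]mulr1.
  by rewrite !ffunE eq_sym (negbTE ba) scaler0.
apply: memv_suml => a _; have [->|/cK[aK aj]] := eqVneq (c a) 0.
  by rewrite scale0r mem0v.
by apply/memvZ/memv_span/map_f; rewrite mem_filter aj eqxx mem_enum.
Qed.

Lemma boundaries_sub_cycles K j :
  simplicial_complex K -> (boundaries K j <= cycles K j)%VS.
Proof.
move=> [_ Kdown]; apply/subvP=> _ /memv_imgP[c /memv_chains cK ->].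
rewrite memv_cap memv_ker !lfunE /= boundaryK eqxx andbT.
apply/memv_chains=> b; rewrite ffunE; case: ifP => [|_ nz]; first by rewrite eqxx.
have [x /andP[xb]|nz0] := pickP (fun x => (x \notin b) && (c (x |: b) != 0)).
  move=> /cK[aK]; rewrite cardsU1 xb => -[bj].
  by split=> //; apply: Kdown aK _; rewrite subsetUr.
case/eqP: nz; apply: big1 => x xb.
by have := nz0 x; rewrite xb => /negbFE/eqP ->; rewrite mulr0.
Qed.

(* H_j(K) is the quotient of [cycles K j] by this relation. *)
Definition homologous K j (z w : chain) : Prop := z - w \in boundaries K j.

(* The map H_j(Y) -> H_j(X) sends the class of z in Y to the class of z in X. *)
Definition injective_on_homology Y X j : Prop :=
  forall z w, z \in cycles Y j -> w \in cycles Y j ->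
    homologous X j z w -> homologous Y j z w.

Definition betti K j : nat := (\dim (cycles K j) - \dim (boundaries K j))%N.

(* For connected closed d-manifolds X: the top homology is isomorphic to F. *)
Definition orientable (d : nat) X : Prop := betti X d = 1%N.

Definition tight (d : nat) X : Prop :=
  [/\ dim_complex d X, connected X
    & forall A, A \subset vertices X ->
        forall j, (j <= d)%N -> injective_on_homology (induced X A) X j].

End Homology.

Arguments betti F {T} K j.
Arguments orientable F {T} d X.
Arguments tight F {T} d X.

(* Main.v *)
From HB Require Import structures.
Require Import Defs.
From mathcomp Require Import all_boot all_order all_algebra.
From mathcomp Require Import ring zify.

(* Write [H_j(M[A]) -> H_j(M)] injective as: every (j+1)-chain of M whose
   boundary lies in M[A] can be replaced by one in M[A].  This is clear for
   j = 0 (cone from a vertex of A), for j = d, and for j = d - 1 (subtract a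
   multiple of the fundamental cycle).

   For d >= 4 and 0 < j < d - 1, add to M all the simplices whose triangles are
   in M.  The vertex links become the clique complexes of stacked spheres; the
   graph of a stacked sphere is chordal, so these and all their induced
   subcomplexes have no homology in positive degree, and the vertices outside A
   can be removed one by one from a chain.

   For d = 3 and j = 1, adding a vertex x to B changes dim B_1(M[B]) by the rank
   of the graph of lk(x)[B] plus the dimension of the kernel of
   H_1(M[B]) -> H_1(M[B + x]).  Averaging over all orders in which the vertices
   can be added gives beta_1(M) = (n - 4)(n - 5) / 20 - R, where R is a sum with
   positive weights of the dimensions of these kernels; hence the formula holds
   if and only if all the kernels vanish.

   A tight M is orientable because the fundamental cycle of a vertex link, which
   bounds the star, also bounds a chain missing the vertex; the difference of
   the two is a nonzero d-cycle. *)

Set Implicit Arguments.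
Unset Strict Implicit.
Unset Printing Implicit Defensive.

Import GRing.Theory Num.Theory Order.TTheory.
Local Open Scope ring_scope.

(** * Contraction and exterior multiplication on chains *)

Section Chains.

Variables (F : fieldType) (T : finType).
Implicit Types (K L M S : {set {set T}}) (a b A B : {set T}) (x y : T).
Implicit Type P : {set T} -> Prop.

Notation chain := {ffun {set T} -> F^o}.
Implicit Types c u z : chain.

Local Notation sg x b := (inc_sign F x b).

Lemma inc_sign_sqr x b : sg x b * sg x b = 1.
Proof. by rewrite -expr2 /inc_sign sqrr_sign. Qed.

Lemma inc_sign_neq0 x b : sg x b != 0.
Proof. by rewrite /inc_sign signr_eq0. Qed.

Lemma inc_signU x y b : x \notin b ->
  sg y (x |: b) = (-1) ^+ (enum_rank x < enum_rank y)%N * sg y b.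
Proof.
move=> xb; rewrite /inc_sign -exprD; congr (_ ^+ _).
have [xy|yx] := boolP (enum_rank x < enum_rank y)%N.
  rewrite (_ : [set z in x |: b | _] =
               x |: [set z in b | (enum_rank z < enum_rank y)%N]).
    by rewrite cardsU1 !inE (negbTE xb).
  by apply/setP=> z; rewrite !inE; case: eqP => // ->; rewrite xy.
apply: eq_card => z; rewrite !inE; case: eqP => // ->.
by rewrite (negbTE yx) ?andbF.
Qed.

Lemma rank_sign x y : x != y ->
  (-1) ^+ (enum_rank x < enum_rank y)%N
    = - (-1) ^+ (enum_rank y < enum_rank x)%N :> F.
Proof.
rewrite -(inj_eq enum_rank_inj) -(inj_eq val_inj) /=.
by case: ltngtP => //= _ _; rewrite ?expr0 ?expr1 ?opprK.
Qed.

Definition ins x c : chain :=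
  [ffun a : {set T} => if x \in a then sg x (a :\ x) * c (a :\ x) else 0].

Definition del x c : chain :=
  [ffun b : {set T} => if x \in b then 0 else sg x b * c (x |: b)].

Lemma ins_is_linear x : linear (ins x).
Proof.
move=> k c c'; apply/ffunP=> a; rewrite !ffunE; case: ifP => _.
  by rewrite mulrDr /GRing.scale /= mulrCA.
by rewrite scaler0 addr0.
Qed.

HB.instance Definition _ x :=
  GRing.isLinear.Build F chain chain *:%R (ins x) (ins_is_linear x).

Lemma del_is_linear x : linear (del x).
Proof.
move=> k c c'; apply/ffunP=> a; rewrite !ffunE; case: ifP => _.
  by rewrite scaler0 addr0.
by rewrite mulrDr /GRing.scale /= mulrCA.
Qed.

HB.instance Definition _ x :=
  GRing.isLinear.Build F chain chain *:%R (del x) (del_is_linear x).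

(* The reduced boundary: unlike [boundary] it keeps the coefficient at the
   empty face.  [ins x] and [del x] are exterior multiplication by x and
   contraction with x, so that [bd] is a sum of contractions. *)
Definition bd c : chain :=
  \sum_x del x c.

Lemma bd_is_linear : linear bd.
Proof.
move=> k c c'; rewrite /bd scaler_sumr -big_split /=.
by apply: eq_bigr => x _; rewrite linearP.
Qed.

HB.instance Definition _ :=
  GRing.isLinear.Build F chain chain *:%R bd bd_is_linear.

(** The first summand collects the faces of c that contain x, the second those that avoid x. *)
Lemma ins_del x c : ins x (del x c) + del x (ins x c) = c.
Proof.
apply/ffunP=> a; rewrite !ffunE; case: ifP => xa.
  by rewrite !inE eqxx /= mulrA inc_sign_sqr mul1r addr0 setD1K.
by rewrite setU11 add0r setU1K ?xa // mulrA inc_sign_sqr mul1r.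
Qed.

Lemma del_del x c : del x (del x c) = 0.
Proof.
by apply/ffunP=> a; rewrite !ffunE setU11 mulr0; case: ifP.
Qed.

Lemma del_ins_neq x y c : x != y -> del x (ins y c) = - ins y (del x c).
Proof.
move=> xy; apply/ffunP=> a; rewrite !ffunE.
have [ya|ya] := boolP (y \in a); last first.
  by rewrite !inE (negbTE ya) eq_sym (negbTE xy) mulr0 oppr0; case: ifP.
have [b yb ->] : exists2 b : {set T}, y \notin b & a = y |: b.
  by exists (a :\ y); rewrite ?setD11 ?setD1K.
have yx : y \notin [set x] by rewrite inE eq_sym.
rewrite setUCA !setU1K ?in_setU ?(negbTE yx) //.
rewrite !in_set1 eqxx (negbTE xy) /=.
have [xb|xb] := boolP (x \in b); first by rewrite mulr0 oppr0.
rewrite !inc_signU // (rank_sign xy); set s := _ ^+ _.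
have ss : s * s = 1 by rewrite -expr2 sqrr_sign.
by rewrite -[RHS]mul1r -ss; ring.
Qed.

Lemma del_del_neq x y c : x != y -> del x (del y c) = - del y (del x c).
Proof.
move=> xy; apply/ffunP=> a; rewrite !ffunE !inE [y == x]eq_sym (negbTE xy) /=.
have [xa|xa] := boolP (x \in a); first by case: ifP; rewrite ?mulr0 oppr0.
have [ya|ya] := boolP (y \in a); first by rewrite mulr0 oppr0.
by rewrite !inc_signU // (rank_sign xy) setUCA; ring.
Qed.

(** The contraction with x contributes [c - ins x (del x c)], and every other contraction
    anticommutes with [ins x]. Thus [ins x] is the cone construction, a contracting homotopy for
    [bd]. *)
Lemma bd_ins x c : bd (ins x c) = c - ins x (bd c).
Proof.
rewrite /bd linear_sum /= (bigD1 x) //= [in RHS](bigD1 x) //= opprD addrA.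
have -> : del x (ins x c) = c - ins x (del x c).
  by apply/eqP; rewrite eq_sym subr_eq addrC ins_del.
congr (_ + _).
by rewrite -sumrN; apply: eq_bigr => y yx; rewrite del_ins_neq.
Qed.

Lemma del_bd x c : del x (bd c) = - bd (del x c).
Proof.
rewrite /bd linear_sum /= -sumrN; apply: eq_bigr => y _.
have [->|xy] := eqVneq x y; first by rewrite del_del oppr0.
by rewrite del_del_neq.
Qed.

(** Contractions anticommute and square to zero, so the terms for (x, y) and (y, x) cancel; the
    ranks of the points serve to select each pair once. *)
Lemma bd_bd c : bd (bd c) = 0.
Proof.
pose r x := enum_rank x : nat; pose f x y := del x (del y c).
have r_neq x y : (r x < r y)%N -> x != y by apply: contraTneq => ->; rewrite ltnn.
have -> : bd (bd c) = \sum_x \sum_(y | (r x < r y)%N) f x y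
                    + \sum_x \sum_(y | (r y < r x)%N) f x y.
  rewrite -big_split; apply: eq_bigr => x _ /=; rewrite /bd linear_sum /=.
  rewrite (bigID (fun y => (r x < r y)%N)) /=; congr (_ + _).
  rewrite (bigD1 x) ?ltnn //= del_del add0r; apply: eq_bigl => y.
  rewrite -leqNgt [RHS]ltn_neqAle andbC; congr (_ && _).
  by rewrite (inj_eq (inj_comp val_inj enum_rank_inj)).
rewrite [X in _ + X](exchange_big_dep predT) //= -big_split big1 //= => x _.
rewrite -big_split big1 //= => y xy.
by rewrite /f del_del_neq ?addNr // r_neq.
Qed.

(** * Supports of chains *)

Definition supp P c : Prop := forall a, c a != 0 -> P a.

Lemma supp_sub P P' c : supp P c -> (forall a, P a -> P' a) -> supp P' c.
Proof. by move=> Pc PP' a /Pc/PP'. Qed.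

Lemma supp0 P : supp P 0.
Proof. by move=> a; rewrite ffunE eqxx. Qed.

Lemma supp_lin P k c c' : supp P c -> supp P c' -> supp P (k *: c + c').
Proof.
move=> Pc Pc' a; rewrite !ffunE; have [->|/Pc //] := eqVneq (c a) 0.
by rewrite scaler0 add0r => /Pc'.
Qed.

Lemma suppD P c c' : supp P c -> supp P c' -> supp P (c + c').
Proof. by move=> Pc Pc'; rewrite -[c]scale1r; apply: supp_lin. Qed.

Lemma suppZ P k c : supp P c -> supp P (k *: c).
Proof. by move=> Pc; rewrite -[_ *: _]addr0; apply: supp_lin => //; exact: supp0. Qed.

Lemma suppN P c : supp P c -> supp P (- c).
Proof. by rewrite -scaleN1r; apply: suppZ. Qed.

Lemma suppB P c c' : supp P c -> supp P c' -> supp P (c - c').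
Proof. by move=> Pc Pc'; apply: suppD => //; apply: suppN. Qed.

Lemma supp_elementary P a : P a -> supp P (elementary F a).
Proof. by move=> Pa b; rewrite ffunE; have [->|] := eqVneq b a; rewrite ?eqxx. Qed.

Lemma supp_ins P x c :
  supp P c -> supp (fun a => x \in a /\ P (a :\ x)) (ins x c).
Proof.
move=> Pc a; rewrite ffunE; case: ifP => [xa|_]; last by rewrite eqxx.
by rewrite mulf_eq0 (negbTE (inc_sign_neq0 _ _)) => /Pc.
Qed.

Lemma supp_del P x c :
  supp P c -> supp (fun b => x \notin b /\ P (x |: b)) (del x c).
Proof.
move=> Pc b; rewrite ffunE; case: ifP => [_|xb]; first by rewrite eqxx.
by rewrite mulf_eq0 (negbTE (inc_sign_neq0 _ _)) => /Pc.
Qed.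

Lemma supp_bd P c :
  supp P c -> supp (fun b => exists2 x, x \notin b & P (x |: b)) (bd c).
Proof.
move=> Pc b; rewrite sum_ffunE => nz.
have [/existsP[x /(supp_del Pc)[]]|] := boolP [exists x, del x c b != 0].
  by exists x.
rewrite negb_exists => /forallP z; case/eqP: nz.
by apply: big1 => x _; have := z x; rewrite negbK => /eqP.
Qed.

Lemma del_eq0 x c : supp (fun a => x \notin a) c -> del x c = 0.
Proof.
move=> xc; apply/ffunP=> b; rewrite !ffunE; case: ifP => // _.
have [->|/xc] := eqVneq (c (x |: b)) 0; first by rewrite mulr0.
by rewrite setU11.
Qed.

Lemma del0_supp x c : del x c = 0 -> supp (fun a => x \notin a) c.
Proof.
move=> rx a; apply: contraNN => xa; have := ins_del x c.
by rewrite rx linear0 add0r => <-; rewrite ffunE xa.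
Qed.

Lemma del_ins x c : supp (fun a => x \notin a) c -> del x (ins x c) = c.
Proof. by move/del_eq0 => rx; rewrite -[RHS](ins_del x) rx linear0 add0r. Qed.

Lemma del_apply x c a : x \in a -> del x c (a :\ x) = inc_sign F x (a :\ x) * c a.
Proof. by move=> xa; rewrite ffunE setD11 setD1K. Qed.

Lemma boundaryE c b : boundary c b = if b == set0 then 0 else bd c b.
Proof.
rewrite ffunE sum_ffunE; case: ifP => // _.
rewrite [RHS](bigID (fun x => x \notin b)) /= [X in _ + X]big1 ?addr0.
  by apply: eq_bigr => x xb; rewrite ffunE (negbTE xb).
by move=> x /negbNE xb; rewrite ffunE xb.
Qed.

(** Only one-point faces contribute to the coefficient of [bd c] at the empty face, so the reduced
    and unreduced boundaries agree above degree 0. *)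
Lemma boundary_bd c : supp (fun a => (1 < #|a|)%N) c -> boundary c = bd c.
Proof.
move=> c1; apply/ffunP=> b; rewrite boundaryE; case: eqP => [->|//].
rewrite sum_ffunE big1 // => x _; rewrite ffunE inE setU0.
have [->|/c1] := eqVneq (c [set x]) 0; first by rewrite mulr0.
by rewrite cards1.
Qed.

Lemma memv_boundaries K j t :
  t \in boundaries F K j <->
  exists2 c, supp (fun a => a \in K /\ #|a| = j.+2) c & t = bd c.
Proof.
split=> [/memv_imgP[c /memv_chains cK ->]|[c cK ->]].
  by exists c => //; rewrite lfunE /= boundary_bd // => a /cK[_ ->].
rewrite -boundary_bd => [|a /cK[_ ->] //].
by rewrite -[boundary c](lfunE (@boundary F T)) memv_img //; apply/memv_chains.
Qed.

Lemma memv_cycles K j c : (0 < j)%N ->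
  c \in cycles F K j <->
  supp (fun a => a \in K /\ #|a| = j.+1) c /\ bd c = 0.
Proof.
move=> j0; rewrite memv_cap memv_ker lfunE /=; split.
  case/andP=> /memv_chains cK; rewrite boundary_bd => [/eqP|a /cK[_ ->]] //.
case=> cK bc; rewrite boundary_bd ?bc ?eqxx ?andbT; last by move=> a /cK[_ ->].
exact/memv_chains.
Qed.

Lemma bd_ins_cycle x c : bd c = 0 -> bd (ins x c) = c.
Proof. by rewrite bd_ins => ->; rewrite linear0 subr0. Qed.

Lemma supp_ins_simplex a y n c : y \in a ->
  supp (fun b => b \subset a /\ #|b| = n) c ->
  supp (fun b => b \subset a /\ #|b| = n.+1) (ins y c).
Proof.
move=> ya cP b /(supp_ins cP) [yb [ba bn]]; split.
  by rewrite -(setD1K yb) subUset sub1set ya.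
by rewrite (cardsD1 y) yb bn.
Qed.

Lemma bd_elementary a y : y \in a ->
  bd (elementary F a) (a :\ y) = inc_sign F y (a :\ y).
Proof.
move=> ya; rewrite sum_ffunE (bigD1 y) //= big1 ?addr0 => [|x xy].
  by rewrite del_apply // ffunE eqxx mulr1.
rewrite !ffunE; case: ifP => // xa; case: eqP => [e|]; last by rewrite mulr0.
by have := setU11 x (a :\ y); rewrite e => xin; move: xa; rewrite !inE xy xin.
Qed.

Lemma supp_bd_elementary a n : #|a| = n.+1 ->
  supp (fun b => b \subset a /\ #|b| = n) (bd (elementary F a)).
Proof.
move=> an b /(supp_bd (supp_elementary (P := fun b => b = a) erefl)).
case=> x xb e; move: an; rewrite -e cardsU1 xb add1n => -[<-].
by rewrite subsetUr.
Qed.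

Lemma bd_vertex x : bd (elementary F [set x]) = elementary F set0.
Proof.
apply/ffunP=> b; rewrite [RHS]ffunE; case: eqP => [->|b0].
  have := bd_elementary (set11 x); rewrite setDv => ->.
  by rewrite /inc_sign (_ : [set _ in _ | _] = set0) ?cards0 //; apply/setP=> y; rewrite !inE.
apply/eqP/negPn/negP => /(supp_bd_elementary (n := 0) (cards1 x))[_ /eqP].
by rewrite cards_eq0 => /eqP.
Qed.

Lemma ins_empty x : ins x (elementary F set0) = elementary F [set x].
Proof.
apply/ffunP=> a; rewrite !ffunE; have [xa|xa] := boolP (x \in a); last first.
  by case: eqP => // e; rewrite e set11 in xa.
have -> : (a == [set x]) = (a \subset [set x]) by rewrite eqEsubset sub1set xa andbT.
have -> : (a :\ x == set0) = (a \subset [set x]) by apply: setD_eq0.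
have [ax|_] := boolP (a \subset [set x]); last by rewrite mulr0.
have -> : a :\ x = set0 by apply/eqP; rewrite setD_eq0.
by rewrite /inc_sign (_ : [set _ in _ | _] = set0) ?cards0 ?mulr1 //; apply/setP=> y; rewrite !inE.
Qed.

(** The cone over c from a point of a lives on faces with as many points as a, hence on a alone, and
    its boundary is c. *)
Lemma simplex_cycle a n c : #|a| = n.+1 ->
  supp (fun b => b \subset a /\ #|b| = n) c -> bd c = 0 ->
  exists k, c = k *: bd (elementary F a).
Proof.
move=> an cP bc; have /set0Pn[y ya] : a != set0 by rewrite -card_gt0 an.
exists (ins y c a); rewrite -linearZ -{1}(bd_ins_cycle y bc); congr bd.
apply/ffunP=> b; rewrite [RHS]ffunE [elementary _ _ _]ffunE.
case: eqP => [->|ba]; first by rewrite [RHS]mulr1.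
rewrite scaler0; apply/eqP/negPn/negP => /(supp_ins_simplex ya cP)[sba bn].
by apply/ba/eqP; rewrite eqEcard sba an bn /=.
Qed.

End Chains.

(** * Stacked spheres *)

Section StackedSpheres.

Variable T : finType.
Implicit Types (K L M : {set {set T}}) (a b c A B : {set T}) (x y : T).

Lemma subset_setU1 x a b : b \subset x |: a -> x \notin b -> b \subset a.
Proof.
move=> /subsetP bxa xb; apply/subsetP=> y yb.
by have := bxa y yb; rewrite !inE => /orP[/eqP yx|//]; rewrite -yx yb in xb.
Qed.

Lemma vertices_mem K x a : simplicial_complex K -> a \in K -> x \in a ->
  x \in vertices K.
Proof. by move=> [_ cK] aK xa; rewrite inE; apply: cK aK _; rewrite sub1set. Qed.

Lemma notin_face K x a : simplicial_complex K -> x \notin vertices K ->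
  a \in K -> x \notin a.
Proof. by move=> cK xK aK; apply: contra xK; apply: vertices_mem. Qed.

Lemma facet_mem K a : facet K a -> a \in K.
Proof. exact: maxsetp. Qed.

Definition move1 K a x := (K :\ a) :|: cone x (bd_simplex a).

Section Move.

Variables (K : {set {set T}}) (a : {set T}) (x : T).
Hypotheses (cK : simplicial_complex K) (fa : facet K a) (xK : x \notin vertices K).

(** Later arguments on a move split the faces by whether they contain the new vertex; this lemma and
    [move1_in] describe the two kinds. *)
Lemma move1_notin b : x \notin b -> (b \in move1 K a x) = (b \in K) && (b != a).
Proof.
move=> xb; rewrite !inE; have [ba|ba] := boolP (b \proper a).
  rewrite /= orbT (proj2 cK _ _ (facet_mem fa)) ?proper_sub //.
  by apply/esym/eqP => e; rewrite e properxx in ba.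
rewrite andbC /=; apply/idP/idP => [|->] //.
by case/orP => // /imsetP[c _ e]; rewrite e setU11 in xb.
Qed.

Lemma move1_in b : x \notin b -> (x |: b \in move1 K a x) = (b \proper a).
Proof.
move=> xb; rewrite !inE; apply/idP/idP => [|ba].
  have xbF : x |: b \in K = false.
    by apply: contraNF xK => /(vertices_mem cK)-> //; rewrite setU11.
  rewrite xbF andbF /=; case/orP => [/proper_sub/subsetP/(_ x)|].
    rewrite setU11 => /(_ isT) xa; case/negP: xK.
    exact: vertices_mem (facet_mem fa) _.
  case/imsetP => c; rewrite inE => ca e.
  rewrite -(setU1K xb) e setU1K //; apply: (notin_face cK xK).
  exact: (proj2 cK) (facet_mem fa) (proper_sub ca).
by apply/orP; right; apply/orP; right; apply/imsetP; exists b; rewrite ?inE.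
Qed.

Lemma move1_complex : a != set0 -> simplicial_complex (move1 K a x).
Proof.
move=> a0; split.
  by rewrite move1_notin ?inE // (proj1 cK) eq_sym.
move=> b c; have [xb|xb] := boolP (x \in b).
  rewrite -{1}(setD1K xb) move1_in ?setD11 // => ba cb.
  have [xc|xc] := boolP (x \in c).
    rewrite -(setD1K xc) move1_in ?setD11 //.
    by apply: sub_proper_trans ba; apply: setSD.
  have {cb}ca : c \proper a by apply: sub_proper_trans ba; rewrite subsetD1 cb.
  rewrite move1_notin // (proj2 cK _ _ (facet_mem fa)) ?proper_sub //.
  by apply: contraTneq ca => ->; rewrite properxx.
move=> + cb; rewrite move1_notin // => /andP[bK ba].
have xc : x \notin c by apply: contra xb; apply: (subsetP cb).
rewrite move1_notin // (proj2 cK _ _ bK cb) /=.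
apply: contra ba => /eqP ca; rewrite ca in cb.
by apply/eqP; case/maxsetP: fa => _; apply.
Qed.

Lemma vertices_move1 : (1 < #|a|)%N -> vertices (move1 K a x) = x |: vertices K.
Proof.
move=> a1; apply/setP=> y; rewrite inE in_setU1 [RHS]/= [in RHS]inE.
have [->|yx] /= := eqVneq y x.
  by rewrite -[[set x]]setU0 move1_in ?inE // proper0 -card_gt0 ltnW.
rewrite move1_notin ?in_set1 1?eq_sym // andb_idr // => _.
by apply: contraTneq a1 => ->; rewrite cards1.
Qed.

End Move.

(** This induction principle also records that K is a complex, which the descriptions of a move
    require. *)
Lemma stellated_ind (P : nat -> {set {set T}} -> Prop) :
  (forall e a, #|a| = e.+2 -> P e (bd_simplex a)) ->
  (forall e K a x, stellated1_sphere e K -> simplicial_complex K ->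
     facet K a -> #|a| = e.+1 -> x \notin vertices K -> P e K ->
     P e (move1 K a x)) ->
  forall e L, stellated1_sphere e L -> P e L.
Proof.
move=> P0 PS e L sL; suff [] : simplicial_complex L /\ P e L by [].
elim: sL => [a ae|K a x sK [cK PK] fa ae xK].
  split; last exact: P0.
  split; first by rewrite inE proper0 -card_gt0 ae.
  by move=> b c; rewrite !inE => ba cb; apply: sub_proper_trans ba.
by split; [apply: move1_complex; rewrite // -card_gt0 ae | apply: PS].
Qed.

Lemma stellated_complex e L : stellated1_sphere e L -> simplicial_complex L.
Proof.
move: e L; apply: stellated_ind => [e a ae|e K a x _ cK fa ae xK _].
  split; first by rewrite inE proper0 -card_gt0 ae.
  by move=> b c; rewrite !inE => ba cb; apply: sub_proper_trans ba.
by apply: move1_complex; rewrite // -card_gt0 ae.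
Qed.

Lemma proper_face a b : b \proper a ->
  exists y, [/\ y \in a, b \subset a :\ y & #|a| = #|a :\ y|.+1].
Proof.
case/properP=> ba [y ya yb]; exists y; split=> //; last by rewrite (cardsD1 y) ya.
by apply/subsetP=> z zb; rewrite !inE (subsetP ba) // andbT; apply: contraNneq yb => <-.
Qed.

Lemma stellated_pure e L : stellated1_sphere e L -> forall b, b \in L ->
  exists a, [/\ a \in L, b \subset a & #|a| = e.+1].
Proof.
move: e L; apply: stellated_ind => [e a ae b|e K a x _ cK fa ae xK IH b].
  rewrite inE => /proper_face[y [ya bay]]; rewrite ae => -[ay].
  by exists (a :\ y); rewrite inE properD1.
have xF c : c \proper a -> x \notin c.
  move=> ca; apply: (notin_face cK xK).
  exact: (proj2 cK) (facet_mem fa) (proper_sub ca).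
have cF c : c \proper a -> exists a', [/\ a' \in move1 K a x, x |: c \subset a' & #|a'| = e.+1].
  move=> /[dup] ca /proper_face[y [ya cay]]; rewrite ae => -[ay].
  have xay : x \notin a :\ y by apply/xF/properD1.
  by exists (x |: a :\ y); rewrite move1_in ?properD1 // setUS // cardsU1 xay -ay.
have [xb|xb] := boolP (x \in b).
  by rewrite -(setD1K xb) move1_in ?setD11 // => /cF.
rewrite move1_notin // => /andP[bK ba]; have [a' [a'K ba' a'e]] := IH b bK.
(* If the facet found in K is the one removed by the move, b is a proper face of it and lies in a
   facet of the new cone. *)
have [aa'|aa'] := eqVneq a' a.
  have /cF[c [cK' bc ce]] : b \proper a by rewrite properEneq ba -aa'.
  by exists c; split=> //; apply: subset_trans bc; apply: subsetUr.
have xa' := notin_face cK xK a'K.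
by exists a'; rewrite move1_notin ?a'K.
Qed.

Lemma simplex_of_card a e b : #|a| = e.+1 -> b \subset a -> #|b| = e ->
  exists2 y, y \in a & b = a :\ y.
Proof.
move=> ae ba be; have /proper_face[y [ya bay]] : b \proper a.
  by rewrite properEcard ba ae be /=.
rewrite ae => -[ay]; exists y => //; apply/eqP.
by rewrite eqEcard bay be ay /=.
Qed.

Variable F : fieldType.
Notation chain := {ffun {set T} -> F^o}.

(** The fundamental cycle is nowhere zero on the facets and spans the top cycles. A move alters it
    by the multiple of the boundary of the simplex on x and a that cancels its coefficient at a. *)
Lemma stellated_fundamental e L : stellated1_sphere e L ->
  exists z : chain,
    [/\ supp (fun b => b \in L /\ #|b| = e.+1) z, bd z = 0,
        forall b, b \in L -> #|b| = e.+1 -> z b != 0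
      & forall c : chain, supp (fun b => b \in L /\ #|b| = e.+1) c ->
          bd c = 0 -> exists k, c = k *: z].
Proof.
move: e L; apply: stellated_ind => [e a ae|e K a x _ cK fa ae xK].
  have P b : b \in bd_simplex a /\ #|b| = e.+1 <-> b \subset a /\ #|b| = e.+1.
    rewrite inE; split=> -[ba be]; split=> //; first exact: proper_sub.
    by rewrite properEcard ba be ae /=.
  exists (bd (elementary F a)); split.
  - by apply: supp_sub (supp_bd_elementary ae) _ => b /P.
  - exact: bd_bd.
  - move=> b bK be; have [ba _] : b \subset a /\ #|b| = e.+1 by apply/P.
    have [y ya ->] := simplex_of_card ae ba be.
    by rewrite bd_elementary // inc_sign_neq0.
  - by move=> c cP; apply: simplex_cycle ae _; apply: supp_sub cP _ => b /P.
case=> z [zK bz z0 zu].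
have aK := facet_mem fa; have xa := notin_face cK xK aK.
have supp_a : supp (fun b => b = a) (elementary F a) by apply: supp_elementary.
(* Up to sign, w is the boundary of the simplex x |: a; it has coefficient 1 at a. *)
pose w : chain := bd (ins x (elementary F a)).
have wE : w = elementary F a - ins x (bd (elementary F a)) by apply: bd_ins.
have w_notin b : x \notin b -> w b = (b == a)%:R.
  by move=> xb; rewrite wE !ffunE (negbTE xb) subr0.
have w_in b : x \notin b -> w (x |: b) = - (inc_sign F x b * bd (elementary F a) b).
  move=> xb; rewrite wE !ffunE setU11 setU1K //; case: eqP => [e'|]; last by rewrite sub0r.
  by rewrite -e' setU11 in xa.
have properP b : b \subset a /\ #|b| = e -> b \proper a.
  by case=> ba be; rewrite properEcard ba be ae /=.
have supp_notin b : x \notin b -> (b \in move1 K a x /\ #|b| = e.+1) <-> 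
   [/\ b \in K, #|b| = e.+1 & b != a].
  by move=> xb; rewrite move1_notin //; split=> [[/andP[]]|[->-> ->]].
have supp_in b : x \notin b -> (x |: b \in move1 K a x /\ #|x |: b| = e.+1) <-> 
   b \subset a /\ #|b| = e.
  move=> xb; rewrite move1_in // cardsU1 xb.
  by split=> [[/proper_sub ba []]|[ba be]]; last by rewrite properP ?be.
have zx0 c : z (x |: c) = 0.
  apply/eqP/negPn/negP => nz; have [xcK _] := zK _ nz; case/negP: xK.
  by apply: vertices_mem xcK _; rewrite // setU11.
exists (z - z a *: w); split.
- move=> b; have [xb|xb] := boolP (x \in b).
    rewrite -(setD1K xb); move: (b :\ x) (setD11 x b) => c /negbT xc nz.
    apply/supp_in => //; apply: (supp_bd_elementary (F := F) ae).
    apply: contraNneq nz => w0.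
    by rewrite !ffunE w_in // zx0 w0 mulr0 oppr0 scaler0 subr0.
  rewrite !ffunE w_notin // => nz; apply/supp_notin => //.
  have ba : b != a.
    by apply: contraNneq nz => ->; rewrite eqxx [_ *: _]mulr1 subrr.
  by move: nz; rewrite (negbTE ba) scaler0 subr0 => /(zK b)[].
- by rewrite linearB linearZ /= bz bd_bd scaler0 subr0.
- move=> b bK be; have [xb|xb] := boolP (x \in b).
    move: bK be; rewrite -(setD1K xb); move: (b :\ x) (setD11 x b) => c /negbT xc bK be.
    have [ca ce] : c \subset a /\ #|c| = e by apply/supp_in.
    have [y ya cE] := simplex_of_card ae ca ce.
    rewrite !ffunE w_in // {3}cE bd_elementary // [_ *: _]mulrN opprK.
    by rewrite zx0 add0r !mulf_neq0 ?inc_sign_neq0 // z0.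
  have [bK' _ ba] : [/\ b \in K, #|b| = e.+1 & b != a] by apply/supp_notin.
  by rewrite !ffunE w_notin // (negbTE ba) scaler0 subr0 z0.
(* The link part u is a cycle on the boundary of a, hence k times [bd (elementary F a)]. Adding k
   times w removes every face through x and leaves a cycle of K, that is k' times z. As c vanishes
   at a, comparing coefficients there gives k = k' * z a. *)
- move=> c cP bc; pose u := del x c.
  have uP : supp (fun b => b \subset a /\ #|b| = e) u.
    by apply: supp_sub (supp_del (x := x) cP) _ => b [xb] /supp_in; apply.
  have bu : bd u = 0 by apply/eqP; rewrite -oppr_eq0 -del_bd bc linear0.
  have [k uk] := simplex_cycle ae uP bu.
  have rw : del x w = - bd (elementary F a).
    by rewrite del_bd del_ins // => b /supp_a /= ->.
  pose c' := c + k *: w.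
  have rc' : del x c' = 0 by rewrite linearD linearZ /= rw -/u uk scalerN subrr.
  have xc' := del0_supp rc'.
  have c'P : supp (fun b => b \in K /\ #|b| = e.+1) c'.
    move=> b nz; have xb := xc' b nz; move: nz; rewrite !ffunE w_notin //.
    have [->|ba] := eqVneq b a; first by rewrite aK ae.
    by rewrite scaler0 addr0 => nz; have /supp_notin[] := cP b nz.
  have [|k' c'z] := zu _ c'P; first by rewrite linearD linearZ /= bc bd_bd scaler0 addr0.
  have kk' : k = k' * z a.
    have : c' a = k' * z a by rewrite c'z ffunE.
    rewrite !ffunE w_notin // eqxx [_ *: _]mulr1.
    suff -> : c a = 0 by rewrite add0r.
    by apply/eqP/negPn/negP => nz; have /supp_notin[] := cP a nz; rewrite ?eqxx.
  exists k'; rewrite scalerBr -c'z scalerA -kk' /c' addrK //.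
Qed.

End StackedSpheres.

(** * Top dimension and codimension one *)

Section Manifold.

Variables (F : fieldType) (T : finType) (d : nat) (M : {set {set T}}).
Hypothesis hM : W1 d M.
Implicit Types (K L S : {set {set T}}) (a b A B : {set T}) (x y : T).

Notation chain := {ffun {set T} -> F^o}.
Implicit Types c u z w : chain.

Lemma W1_complex : simplicial_complex M.
Proof. by case: hM => _ []. Qed.

Lemma W1_face_card a : a \in M -> (#|a| <= d.+1)%N.
Proof.
case: hM => _ [_ <-] _ _ aM.
by have := @leq_bigmax_cond _ (mem M) (fun b => #|b|) a aM.
Qed.

Lemma W1_dim_gt0 : (0 < d)%N.
Proof. by case: hM. Qed.

Lemma W1_link x : x \in vertices M -> stellated1_sphere d.-1 (link x M).
Proof. by case: hM => _ _ _; apply. Qed.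

Lemma W1_vertex : exists x, x \in vertices M.
Proof.
have /set0Pn[a /setDP[aM a0]] : M :\ set0 != set0.
  apply/negP=> /eqP M0; case: hM => _ [_ max_d] _ _.
  suff : (\max_(a in M) #|a| <= 0)%N by rewrite max_d.
  apply/bigmax_leqP => a aM; rewrite leqn0 cards_eq0.
  have /setP/(_ a) := M0; rewrite !inE aM andbT => /negbT.
  by rewrite negbK.
have /set0Pn[x xa] : a != set0 by move: a0; rewrite inE.
by exists x; apply: vertices_mem W1_complex aM xa.
Qed.

Lemma supp_del_link x n c : supp (fun a => a \in M /\ #|a| = n.+1) c ->
  supp (fun b => b \in link x M /\ #|b| = n) (del x c).
Proof.
move=> cM; apply: supp_sub (supp_del (x := x) cM) _ => b [xb [xbM]].
rewrite cardsU1 xb => -[<-]; split=> //; rewrite inE xb xbM andbT.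
by rewrite /= andbT; apply: (proj2 W1_complex) xbM _; apply: subsetUr.
Qed.

Lemma supp_ins_link x n c : supp (fun b => b \in link x M /\ #|b| = n) c ->
  supp (fun a => a \in M /\ #|a| = n.+1) (ins x c).
Proof.
move=> cL; apply: supp_sub (supp_ins (x := x) cL) _ => a [xa []].
by rewrite inE setD1K // (cardsD1 x a) xa => /and3P[_ _ ->] ->.
Qed.

Lemma supp_notin_link x n c : supp (fun b => b \in link x M /\ #|b| = n) c ->
  supp (fun b => x \notin b) c.
Proof. by move/supp_sub; apply=> b []; rewrite inE => /and3P[]. Qed.

(** The hypothesis on [bd c] makes [del x c] a top cycle of the link, hence a multiple of its
    nowhere zero fundamental cycle; one vanishing coefficient kills the multiple. *)
Lemma del_eq0_facet x c a : supp (fun a => a \in M /\ #|a| = d.+1) c ->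
  del x (bd c) = 0 -> a \in M -> #|a| = d.+1 -> x \in a -> c a = 0 ->
  del x c = 0.
Proof.
move=> cM bc aM ad xa ca; have dE := prednK W1_dim_gt0.
have xV := vertices_mem W1_complex aM xa.
have [z [_ _ z0 zu]] := stellated_fundamental F (W1_link xV).
have [||k uk] := zu (del x c); first by rewrite dE; apply: supp_del_link.
  by apply/eqP; rewrite -oppr_eq0 -del_bd bc.
have axL : a :\ x \in link x M.
  rewrite inE setD11 setD1K // aM andbT /= andbT.
  by apply: (proj2 W1_complex) aM _; apply: subsetDl.
have axd : #|a :\ x| = d.-1.+1.
  by move: ad; rewrite dE (cardsD1 x) xa => -[].
have /eqP : k * z (a :\ x) = 0.
  have : del x c (a :\ x) = k * z (a :\ x) by rewrite uk ffunE.
  by rewrite del_apply // ca mulr0.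
by rewrite mulf_eq0 (negbTE (z0 _ axL axd)) orbF uk => /eqP ->; rewrite scale0r.
Qed.

Lemma edge_facet x y : [set x; y] \in M ->
  exists a, [/\ a \in M, #|a| = d.+1, x \in a & y \in a].
Proof.
move=> xyM; have xV : x \in vertices M.
  by apply: vertices_mem W1_complex xyM _; rewrite !inE eqxx.
(* Removing x also covers the case y = x, where this face is empty. *)
have yxL : [set y] :\ x \in link x M.
  have xyE : x |: [set y] :\ x = [set x; y].
    by apply/setP=> z; rewrite !inE; case: eqVneq.
  rewrite inE setD11 xyE xyM !andbT; apply: (proj2 W1_complex) xyM _.
  by rewrite -xyE subsetUr.
have [b [bL yb bcard]] := stellated_pure (W1_link xV) yxL.
have xb : x \notin b by move: bL; rewrite inE => /and3P[].
exists (x |: b); split; rewrite ?setU11 //.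
- by move: bL; rewrite inE => /and3P[].
- by rewrite cardsU1 xb bcard (prednK W1_dim_gt0).
by have := subsetP yb y; rewrite !inE eqxx andbT; case: eqVneq => //= _; apply.
Qed.

(** Some facet contains both x and y, and c vanishes on it because it vanishes near x; this carries
    vanishing along an edge. *)
Lemma del_eq0_edge x y c : supp (fun a => a \in M /\ #|a| = d.+1) c ->
  [set x; y] \in M -> del x c = 0 -> del y (bd c) = 0 -> del y c = 0.
Proof.
move=> cM xyM rx ry; have [a [aM ad xa ya]] := edge_facet xyM.
apply: del_eq0_facet cM ry aM ad ya _.
by apply/eqP; apply: contraTT xa; apply: del0_supp.
Qed.

Lemma eq0_del n c : supp (fun a => a \in M /\ #|a| = n.+1) c ->
  (forall x, x \in vertices M -> del x c = 0) -> c = 0.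
Proof.
move=> cM rc; apply/ffunP=> a; rewrite ffunE; apply/eqP/negPn/negP => nz.
have [aM an] := cM a nz; have /set0Pn[x xa] : a != set0 by rewrite -card_gt0 an.
have := del0_supp (rc x (vertices_mem W1_complex aM xa)) nz.
by rewrite xa.
Qed.

(** Vanishing at one facet spreads to the star of a vertex, and then along edge paths to all stars
    by connectedness. *)
Lemma top_cycle_eq0 c a : supp (fun a => a \in M /\ #|a| = d.+1) c ->
  bd c = 0 -> a \in M -> #|a| = d.+1 -> c a = 0 -> c = 0.
Proof.
move=> cM bc aM ad ca; have r0 x : del x (bd c) = 0 by rewrite bc linear0.
have /set0Pn[x xa] : a != set0 by rewrite -card_gt0 ad.
have xV := vertices_mem W1_complex aM xa.
apply: (eq0_del cM) => y yV; have rx := del_eq0_facet cM (r0 x) aM ad xa ca.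
case: hM => _ _ /(_ x y xV yV)/connectP[p + ->] _.
elim: p x {xa xV} rx => [|v p IH] x rx //= /andP[xvM /IH]; apply.
exact: del_eq0_edge cM xvM rx _.
Qed.

Lemma boundaries_top : boundaries F M d = 0%VS.
Proof.
apply/eqP; rewrite -subv0; apply/subvP => t /memv_boundaries[c cM ->].
suff -> : c = 0 by rewrite linear0 mem0v.
apply/ffunP=> a; rewrite ffunE; apply/eqP/negPn/negP => /cM[/W1_face_card aM ad].
by rewrite ad ltnn in aM.
Qed.

(** From any other top cycle a multiple of z can be subtracted to make it vanish at a chosen facet,
    hence everywhere; so the top cycles form a line. *)
Lemma orientable_of_cycle z : supp (fun a => a \in M /\ #|a| = d.+1) z ->
  bd z = 0 -> z != 0 -> orientable F d M.
Proof.
move=> zM bz z0; rewrite /orientable /betti boundaries_top dimv0 subn0.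
have [a za] : exists a, z a != 0.
  apply/existsP; apply: contraNT z0; rewrite negb_exists => /forallP zz.
  by apply/eqP/ffunP=> a; rewrite ffunE; apply/eqP; have := zz a; rewrite negbK.
have [aM ad] := zM a za.
suff -> : cycles F M d = <[z]>%VS by rewrite dim_vline z0.
apply/vspaceP=> c; apply/idP/idP => [/memv_cycles|/vlineP[k ->]]; last first.
  by apply/memvZ/memv_cycles; rewrite ?W1_dim_gt0.
case=> [|cM bc]; first exact: W1_dim_gt0.
apply/vlineP; exists (c a / z a); apply/eqP; rewrite -subr_eq0; apply/eqP.
apply: (@top_cycle_eq0 _ a) => //.
- by apply: suppB => //; apply: suppZ.
- by rewrite linearB linearZ /= bc bz scaler0 subr0.
by rewrite !ffunE [_ *: _]divfK // subrr.
Qed.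

Lemma fundamental_cycle : orientable F d M ->
  exists z, [/\ supp (fun a => a \in M /\ #|a| = d.+1) z, bd z = 0
    & forall a, a \in M -> #|a| = d.+1 -> z a != 0].
Proof.
rewrite /orientable /betti boundaries_top dimv0 subn0 => dim1.
have : vpick (cycles F M d) \in cycles F M d by apply: memv_pick.
case/memv_cycles => [|zM bz]; first exact: W1_dim_gt0.
exists (vpick (cycles F M d)); split=> // a aM ad.
have : vpick (cycles F M d) != 0 by rewrite vpick0 -dimv_eq0 dim1.
by apply: contraNneq => za; apply/eqP; apply: top_cycle_eq0 aM ad za.
Qed.

(* [H_j(M[A]) -> H_j(M)] is injective, expressed on the chains of M whose
   boundary is supported in A. *)
Definition refillable j A := forall c,
  supp (fun a => a \in M /\ #|a| = j.+2) c -> supp (fun b => b \subset A) (bd c) ->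
  exists2 c', supp (fun a => a \in induced M A /\ #|a| = j.+2) c' & bd c = bd c'.

Lemma refillable_injective j A :
  refillable j A -> injective_on_homology F (induced M A) M j.
Proof.
move=> fillA z w zA wA /memv_boundaries[c cM zw]; rewrite /homologous.
apply/memv_boundaries; rewrite zw; apply: fillA => //; rewrite -zw.
move: zA wA; rewrite !memv_cap => /andP[/memv_chains zA _] /andP[/memv_chains wA _].
have sA c' : (forall a, c' a != 0 -> a \in induced M A /\ #|a| = j.+1) ->
  supp (fun b => b \subset A) c'.
  by move=> c'A a /c'A[]; rewrite inE => /andP[].
by apply: suppB; apply: sA.
Qed.

Lemma injective_refillable j A : (0 < j)%N ->
  injective_on_homology F (induced M A) M j -> refillable j A.
Proof.
move=> j0 injA c cM cA; apply/memv_boundaries; rewrite -[bd c]subr0.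
apply: injA; rewrite ?mem0v //; last first.
  by rewrite /homologous subr0; apply/memv_boundaries; exists c.
apply/memv_cycles => //; split; last exact: bd_bd.
move=> b nz; have [x xb [xbM]] := supp_bd cM nz.
rewrite cardsU1 xb inE (cA b nz) andbT add1n => -[->]; split=> //.
by apply: (proj2 W1_complex) xbM _; apply: subsetUr.
Qed.

Lemma refillable_top A : refillable d A.
Proof.
move=> c cM _; exists 0; first exact: supp0.
suff -> : c = 0 by [].
apply/ffunP=> a; rewrite ffunE; apply/eqP/negPn/negP => /cM[/W1_face_card aM ad].
by rewrite ad ltnn in aM.
Qed.

Lemma refillable0 A : two_neighbourly M -> A \subset vertices M -> refillable 0 A.
Proof.
move=> M2 AV c cM cA; have [A0|[y yA]] := set_0Vmem A.
  exists 0; first exact: supp0.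
  rewrite linear0; apply/ffunP=> b; rewrite ffunE; apply/eqP/negPn/negP => nz.
  have := cA b nz; rewrite A0 subset0 => /eqP b0.
  have [x xb [_]] := supp_bd cM nz.
  by rewrite cardsU1 xb b0 cards0.
exists (ins y (bd c)); last by rewrite bd_ins_cycle // bd_bd.
have cA1 : supp (fun b => b \subset A /\ #|b| = 1%N) (bd c).
  move=> b nz; split; first exact: cA.
  by have [x xb [_]] := supp_bd cM nz; rewrite cardsU1 xb => -[].
move=> a /(supp_ins cA1)[ya [aA a1]].
rewrite (cardsD1 y) ya a1; split=> //; rewrite inE -(setD1K ya).
move/eqP/cards1P: a1 => [x ax]; move: aA; rewrite ax sub1set => xA.
have yx : y != x by have := set11 x; rewrite -ax !inE eq_sym => /andP[].
by rewrite (M2 y x) ?(subsetP AV) // subUset !sub1set yA xA.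
Qed.

(* Subtract from c the multiple of the fundamental cycle that makes it vanish
   near one vertex outside A; then it vanishes near all of them. *)
Lemma refillable_codim1 A : two_neighbourly M -> orientable F d M ->
  A \subset vertices M -> refillable d.-1 A.
Proof.
move=> M2 /fundamental_cycle[z [zM bz z0]] AV c; rewrite (prednK W1_dim_gt0).
move=> cM cA; have [VA|] := boolP (vertices M \subset A).
  exists c => // a /cM[aM ->]; split=> //; rewrite inE aM.
  by apply/subsetP=> x /(vertices_mem W1_complex aM)/(subsetP VA).
case/subsetPn=> x xV xA.
have [a [aM ad xa _]] : exists a, [/\ a \in M, #|a| = d.+1, x \in a & x \in a].
  by apply: edge_facet; rewrite setUid; move: xV; rewrite inE.
pose c' := c - (c a / z a) *: z.
have bc' : bd c' = bd c by rewrite linearB linearZ /= bz scaler0 subr0.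
have c'M : supp (fun a => a \in M /\ #|a| = d.+1) c'.
  by apply: suppB => //; apply: suppZ.
have rA y : y \notin A -> del y (bd c') = 0.
  move=> yA; rewrite bc'; apply: del_eq0; apply: supp_sub cA _ => b bA.
  by apply: contra yA; apply: (subsetP bA).
(* Vanishing near x follows from the choice of the multiple; every other vertex outside A is joined
   to x by an edge. *)
have rx : del x c' = 0.
  have := del_eq0_facet c'M (rA x xA) aM ad xa. apply.
  by rewrite !ffunE [_ *: _]divfK ?subrr ?z0.
exists c' => // b nz; have [bM bd'] := c'M b nz; split=> //; rewrite inE bM /=.
apply/subsetP=> y yb; apply: contraTT yb => yA.
have [yV|yV] := boolP (y \in vertices M); last exact: notin_face W1_complex yV bM.
apply: (del0_supp _ nz); have [<- //|xy] := eqVneq x y.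
by apply: del_eq0_edge c'M (M2 _ _ xV yV xy) rx (rA y yA).
Qed.

(** Two vertices are homologous in the connected M. If they did not form an edge, the subcomplex
    induced on them would have no edge, hence no boundary in degree 0. *)
Lemma tight_two_neighbourly : tight F d M -> two_neighbourly M.
Proof.
case=> _ connM tM x y xV yV xy; apply/negPn/negP => xyM.
pose e v : chain := elementary F [set v].
have e_cyc v A : v \in vertices M -> v \in A -> e v \in cycles F (induced M A) 0.
  rewrite inE => vM vA; rewrite memv_cap memv_ker lfunE /=; apply/andP; split.
    apply/memv_chains=> a; rewrite ffunE; have [->|] := eqVneq a [set v].
      by rewrite cards1 inE vM sub1set.
    by rewrite eqxx.
  apply/eqP/ffunP=> a; rewrite boundaryE bd_vertex !ffunE.
  by case: ifP => // ->.
(* The difference telescopes along a path. Steps that stay at one vertex are possible, since the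
   singletons of vertices are in M, and contribute zero. *)
have : e x - e y \in boundaries F M 0.
  have /connectP[p + ->] := connM x y xV yV.
  elim: p x {xV xy xyM} => [|v p IH] x /=; first by rewrite subrr mem0v.
  case/andP=> xvM /IH vy; rewrite -[e x](subrK (e v)) -addrA memvD //.
  have [->|xv] := eqVneq x v; first by rewrite subrr mem0v.
  apply/memv_boundaries; exists (ins v (e x)); last by rewrite bd_ins bd_vertex ins_empty.
  have ex : supp (fun a => a = [set x]) (e x) by apply: supp_elementary.
  move=> a /(supp_ins ex)[va ax]; rewrite -(setD1K va) ax setUC; split=> //.
  by rewrite cards2 xv.
move/(tM [set x; y] _ 0 isT); rewrite subUset !sub1set xV yV => /(_ isT).
case/(_ (e_cyc _ _ xV _) (e_cyc _ _ yV _))/memv_boundaries; rewrite ?inE ?eqxx ?orbT //.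
move=> c cxy /esym/ffunP/(_ [set x]).
suff -> : c = 0.
  rewrite linear0 !ffunE eqxx (inj_eq set1_inj) (negbTE xy) subr0 => /eqP.
  by rewrite eq_sym oner_eq0.
apply/ffunP=> a; rewrite [RHS]ffunE; apply/eqP/negPn/negP => /cxy[].
rewrite inE => /andP[aM axy] a2; case/negP: xyM.
suff <- : a = [set x; y] by [].
by apply/eqP; rewrite eqEcard axy a2 cards2; case: (x != y).
Qed.

Lemma tight_orientable : tight F d M -> orientable F d M.
Proof.
case=> _ _ tM; have [x xV] := W1_vertex; have dE := prednK W1_dim_gt0.
have [z [zL bz z0 _]] := stellated_fundamental F (W1_link xV).
have xz := supp_notin_link zL.
(* Purity applied to the empty face yields some facet b of the link. *)
have [b [bL _ bd']] := stellated_pure (W1_link xV) (proj1 (stellated_complex (W1_link xV))).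
have : homologous (induced M (vertices M :\ x)) d.-1 z 0.
  apply: (tM _ _ _ _ z 0); rewrite ?mem0v ?subsetDl ?leq_pred //; last first.
    rewrite /homologous subr0; apply/memv_boundaries; exists (ins x z).
      exact: supp_ins_link.
    by rewrite bd_ins_cycle.
  (* The degree d - 1 may be 0, where [memv_cycles] does not apply, so the unreduced boundary is
     treated directly. *)
  rewrite memv_cap memv_ker lfunE /=; apply/andP; split.
    apply/memv_chains => a /zL[aL ad]; split=> //; move: aL; rewrite !inE.
    case/and3P=> aM xa _; rewrite aM subsetD1 xa andbT /=.
    by apply/subsetP=> y /(vertices_mem W1_complex aM).
  by apply/eqP/ffunP=> a; rewrite boundaryE bz !ffunE if_same.
rewrite /homologous subr0 => /memv_boundaries[c cP zc].
apply: (@orientable_of_cycle (ins x z - c)).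
- apply: suppB; first by rewrite -[d in X in supp X]dE; apply: supp_ins_link.
  by apply: supp_sub cP _ => a; rewrite inE dE => -[/andP[]].
- by rewrite linearB /= bd_ins_cycle // zc subrr.
(* The chain c avoids x, so at x |: b the difference has the coefficient of z at b, up to sign. *)
apply/eqP=> /ffunP/(_ (x |: b)); have xb : x \notin b.
  by move: bL; rewrite inE => /and3P[].
rewrite !ffunE setU11 setU1K // [c _](_ : _ = 0).
  apply/eqP; rewrite subr0 mulf_neq0 ?inc_sign_neq0 //; exact: z0.
apply/eqP/negPn/negP => /cP[]; rewrite inE => /andP[_ /subsetP/(_ x)].
by rewrite setU11 !inE eqxx => /(_ isT).
Qed.

End Manifold.

(** * Middle degrees *)

Section Flags.

Variables (F : fieldType) (T : finType).
Implicit Types (K L M S : {set {set T}}) (a b s A B : {set T}) (x y : T).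
Notation chain := {ffun {set T} -> F^o}.
Implicit Types c u v z w : chain.

Lemma supp_del_ins (P : {set T} -> Prop) x c : supp P c ->
  supp (fun a => P a /\ x \notin a) (del x (ins x c)).
Proof.
move=> Pc; apply: supp_sub (supp_del (x := x) (supp_ins (x := x) Pc)) _ => a [xa].
by rewrite setU1K // => -[].
Qed.

(* If the link part of c at x bounds v, then c is homologous to a chain
   avoiding x. *)
Lemma bd_ins_fill x c v : del x c = bd v ->
  c + bd (ins x v) = del x (ins x c) + v.
Proof.
move=> rv; have -> : del x (ins x c) = c - ins x (del x c).
  by apply/eqP; rewrite eq_sym subr_eq addrC ins_del.
by rewrite bd_ins -rv addrA addrAC.
Qed.

(** The filling is the cone from a point of s; an empty s carries no chain on nonempty faces. *)
Lemma simplex_fill s n c : supp (fun b => b \subset s /\ #|b| = n.+1) c ->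
  bd c = 0 ->
  exists2 v, supp (fun b => b \subset s /\ #|b| = n.+2) v & c = bd v.
Proof.
move=> cs bc; have [s0|[y ys]] := set_0Vmem s.
  exists 0; first exact: supp0.
  rewrite linear0; apply/ffunP=> b; rewrite ffunE; apply/eqP/negPn/negP => nz.
  by have [] := cs b nz; rewrite s0 subset0 => /eqP ->; rewrite cards0.
exists (ins y c); first exact: supp_ins_simplex.
by rewrite bd_ins_cycle.
Qed.

(** For k = 2 this is the clique complex of the graph of S; for k = 3 it consists of the sets whose
    vertices, edges and triangles all lie in S. *)
Definition flag k S b := [forall c : {set T}, (c \subset b) && (#|c| <= k)%N ==> (c \in S)].

Lemma flagP k S b :
  reflect (forall c : {set T}, c \subset b -> (#|c| <= k)%N -> c \in S) (flag k S b).
Proof.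
apply: (iffP forallP) => [H c cb ck|H c]; first by have /implyP := H c; rewrite cb ck; apply.
by apply/implyP => /andP[]; apply: H.
Qed.

Lemma flag_bd_simplex a b : (2 < #|a|)%N -> flag 2 (bd_simplex a) b = (b \subset a).
Proof.
move=> a3; apply/flagP/idP => [H|ba c cb c2].
  apply/subsetP=> y yb; have := H [set y]; rewrite sub1set yb cards1 inE.
  by move=> /(_ isT isT)/proper_sub; rewrite sub1set.
by rewrite inE properEcard (subset_trans cb) // (leq_ltn_trans c2).
Qed.

Lemma flag_move1_notin K a x b : simplicial_complex K -> facet K a ->
  x \notin vertices K -> (2 < #|a|)%N -> x \notin b ->
  flag 2 (move1 K a x) b = flag 2 K b.
Proof.
move=> cK fa xK a3 xb.
have H (c : {set T}) : c \subset b -> (#|c| <= 2)%N -> (c \in move1 K a x) = (c \in K).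
  move=> cb c2; rewrite move1_notin //; last by apply: contra xb; apply: (subsetP cb).
  rewrite andb_idr // => _; apply: contraTneq c2 => ->.
  by rewrite -ltnNge.
by apply/flagP/flagP => + c cb c2 => /(_ c cb c2); rewrite H.
Qed.

(** In the new graph x is joined exactly to the points of a, which stay pairwise adjacent because
    the removed face has more than two points. So the clique complex just gains the full simplex x
    |: a. *)
Lemma flag_move1_in K a x b : simplicial_complex K -> facet K a ->
  x \notin vertices K -> (2 < #|a|)%N -> x \notin b ->
  flag 2 (move1 K a x) (x |: b) = (b \subset a).
Proof.
move=> cK fa xK a3 xb; apply/flagP/idP => [H|ba c cxb c2].
  apply/subsetP=> y yb; have yx : x \notin [set y].
    by rewrite inE; apply: contraNneq xb => ->.
  have := H (x |: [set y]); rewrite setUS ?sub1set // cards2 move1_in //.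
  move=> /(_ isT); rewrite -sub1set => H'; apply: proper_sub; apply: H'.
  by case: (x != y).
have [xc|xc] := boolP (x \in c).
  have cxb' : c :\ x \subset b by rewrite subDset.
  rewrite -(setD1K xc) move1_in ?setD11 // properEcard (subset_trans cxb') //=.
  by apply: leq_ltn_trans a3; apply: leq_trans c2; apply/subset_leq_card/subsetDl.
have ca : c \subset a by apply: subset_trans ba; apply: subset_setU1 cxb xc.
rewrite move1_notin // (proj2 cK _ _ (facet_mem fa)) //=.
by apply: contraTneq c2 => ->; rewrite -ltnNge.
Qed.

(** A clique that is not a face is the initial simplex or some x |: a, with e + 2 points, or a facet
    a removed by a move, with e + 1 points. *)
Lemma stellated_flag_face e L : stellated1_sphere e L -> (1 < e)%N ->
  forall b, flag 2 L b -> (#|b| <= e)%N -> b \in L.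
Proof.
move: e L; apply: stellated_ind => [e a ae e2 b|e K a x _ cK fa ae xK IH e2 b].
  rewrite flag_bd_simplex ?ae ?ltnS ?(ltnW e2) // => ba be.
  by rewrite inE properEcard ba ae ltnS (leq_trans be).
have a3 : (2 < #|a|)%N by rewrite ae.
have [xb|xb] := boolP (x \in b).
  rewrite -(setD1K xb) flag_move1_in ?setD11 // cardsU1 setD11 add1n => ba be.
  by rewrite move1_in ?setD11 // properEcard ba ae ltnS ltnW.
rewrite flag_move1_notin // move1_notin // => /(IH e2) H be; rewrite H //.
by apply: contraTneq be => ->; rewrite ae ltnn.
Qed.

(* The graph of a stacked sphere is chordal, so its induced clique complexes
   have no homology in positive degree. *)
Lemma stellated_flag_fill e L : stellated1_sphere e L -> (1 < e)%N ->
  forall B n c,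
    supp (fun b => [/\ flag 2 L b, b \subset B & #|b| = n.+2]) c -> bd c = 0 ->
  exists2 v, supp (fun b => [/\ flag 2 L b, b \subset B & #|b| = n.+3]) v
           & c = bd v.
Proof.
move: e L; apply: stellated_ind => [e a ae e2 B n c|e K a x _ cK fa ae xK IH e2 B n c].
  have a3 : (2 < #|a|)%N by rewrite ae !ltnS ltnW.
  have P b m : [/\ flag 2 (bd_simplex a) b, b \subset B & #|b| = m]
           <-> b \subset a :&: B /\ #|b| = m.
    rewrite flag_bd_simplex // subsetI; split=> [[-> ->]|[/andP[-> ->]]] //.
  move=> /supp_sub cP bc; have [|v vP ->] := @simplex_fill (a :&: B) n.+1 c _ bc.
    by apply: cP => b /P.
  by exists v => //; apply: supp_sub vP _ => b /P.
have a3 : (2 < #|a|)%N by rewrite ae.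
move=> cP bc; have [xB|xB] := boolP (x \in B); last first.
  have notx b : b \subset B -> x \notin b.
    by move=> bB; apply: contra xB; apply: (subsetP bB).
  have [b nz|v vP ->] := IH e2 B n c _ bc.
    have [bK bB bn] := cP b nz.
    by split=> //; rewrite -(flag_move1_notin cK fa xK a3) // notx.
  exists v => //; apply: supp_sub vP _ => b [bK bB bn]; split=> //.
  by rewrite flag_move1_notin // notx.
(* The link of x in the clique complex on B is the full simplex on the points of a in B. Hence the
   link part of c bounds there, and c can be pushed off x and filled by induction. *)
pose u := del x c.
have uP : supp (fun b => b \subset a :&: B /\ #|b| = n.+1) u.
  apply: supp_sub (supp_del (x := x) cP) _ => b [xb [bK bB]].
  rewrite cardsU1 xb add1n => -[->]; rewrite subsetI; split=> //.
  by move: bK; rewrite flag_move1_in // => ->; apply: subset_trans bB; apply: subsetUr.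
have bu : bd u = 0 by apply/eqP; rewrite -oppr_eq0 -del_bd bc linear0.
have [v vP uv] := simplex_fill uP bu.
have cE := bd_ins_fill uv; have xa := notin_face cK xK (facet_mem fa).
have [||f fP fE] := IH e2 B n (del x (ins x c) + v).
- apply: suppD.
    apply: supp_sub (supp_del_ins (x := x) cP) _ => b [[bK bB bn] xb].
    by rewrite -(flag_move1_notin cK fa xK a3 xb).
  apply: supp_sub vP _ => b []; rewrite subsetI => /andP[ba bB] bn; split=> //.
  by apply/flagP=> d db _; apply: (proj2 cK) (facet_mem fa) _; apply: subset_trans ba.
- by rewrite -cE linearD /= bc bd_bd addr0.
(* The term [ins x v] undoes the boundary that was added to push c off x. *)
exists (f - ins x v); last by rewrite linearB /= -fE -cE addrK.
apply: suppB.
  apply: supp_sub fP _ => b [bK bB bn]; split=> //; rewrite flag_move1_notin //.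
  apply: contra xK => xb; rewrite inE; move/flagP: bK; apply; rewrite ?sub1set //.
  by rewrite cards1.
apply: supp_sub (supp_ins (x := x) vP) _ => b [xb []].
rewrite subsetI => /andP[ba bB] bn; rewrite (cardsD1 x) xb bn.
rewrite -(setD1K xb) flag_move1_in ?setD11 // subUset sub1set xB bB.
by split.
Qed.

End Flags.

(** * Passing from the links to M when d is at least 4 *)

Section MiddleDegrees.

Variables (F : fieldType) (T : finType) (d : nat) (M : {set {set T}}).
Hypotheses (hM : W1 d M) (d_ge4 : (3 < d)%N).
Implicit Types (a b A B : {set T}) (x y : T).

Lemma link_dim_gt2 : (2 < d.-1)%N.
Proof. by case: d d_ge4. Qed.

Lemma flag_link x a : x \in a -> flag 3 M a -> flag 2 (link x M) (a :\ x).
Proof.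
move=> xa /flagP aM; apply/flagP=> b /subsetD1P[ba xb] b2.
rewrite inE xb (aM b ba) ?(leq_trans b2) //=.
by apply: aM; rewrite ?subUset ?sub1set ?xa // cardsU1 xb.
Qed.

Lemma W1_flag_face a : flag 3 M a -> (#|a| <= d)%N -> a \in M.
Proof.
have [->|[x xa]] := set_0Vmem a; first by rewrite (proj1 (W1_complex hM)).
move=> aM ad; have xV : x \in vertices M.
  by rewrite inE; move/flagP: aM; apply; rewrite ?sub1set ?cards1.
have : a :\ x \in link x M.
  apply: (stellated_flag_face (W1_link hM xV)) (flag_link xa aM) _.
    by rewrite ltnW ?link_dim_gt2.
  by move: ad d_ge4; rewrite (cardsD1 x a) xa; case: d.
by rewrite inE setD1K // => /and3P[].
Qed.

(** Sets of at most three points that are cliques of the link are faces of it, because the link has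
    dimension d - 1 >= 3. *)
Lemma flag_of_link x b : x \in vertices M -> flag 2 (link x M) b -> flag 3 M b.
Proof.
move=> xV /flagP bL; apply/flagP=> c cb c3.
suff : c \in link x M by rewrite inE => /and3P[].
apply: (stellated_flag_face (W1_link hM xV)); rewrite ?(ltnW link_dim_gt2) //.
  by apply/flagP=> a ac; apply/bL/(subset_trans ac).
exact: leq_trans c3 link_dim_gt2.
Qed.

(* For d >= 4 the complex [flag 3 M] has the same faces as M in
   dimension < d and its vertex links are the clique complexes of those of M,
   hence removing a vertex kills no boundary in positive degree. *)
Lemma refillable_middle j A : (0 < j)%N -> (j.+2 <= d)%N -> refillable F M j A.
Proof.
case: j => // n _ nd c0 c0M c0A.
(* The chain is moved inside the enlarged complex, from B down to A, by removing the vertices of B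
   outside A one at a time. At the end it lies in M again, since its faces have at most d points. *)
suff H (k : nat) B (c : {ffun {set T} -> F^o}) :
    B \subset vertices M -> (#|B :\: A| <= k)%N ->
    supp (fun a => [/\ flag 3 M a, a \subset B & #|a| = n.+3]) c ->
    supp (fun b => b \subset A) (bd c) ->
  exists2 c', supp (fun a => [/\ flag 3 M a, a \subset A & #|a| = n.+3]) c'
            & bd c = bd c'.
  have [|c' c'P ->] := H _ _ c0 (subxx _) (leqnn _) _ c0A.
    move=> a /c0M[aM an]; split=> //.
      by apply/flagP=> b ba _; apply: (proj2 (W1_complex hM)) aM ba.
    by apply/subsetP=> x; apply: vertices_mem (W1_complex hM) aM.
  exists c' => //; apply: supp_sub c'P _ => a [aM aA an].
  by rewrite inE aA W1_flag_face // an.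
elim: k B c => [|k IH] B c BV.
  rewrite leqn0 cards_eq0 setD_eq0 => BA cP _; exists c => //.
  by apply: supp_sub cP _ => a [aM aB an]; split=> //; apply: subset_trans aB BA.
have [BA _ cP _|/subsetPn[x xB xA] Bk cP cA] := boolP (B \subset A).
  by exists c => //; apply: supp_sub cP _ => a [aM aB an]; split=> //; apply: subset_trans aB BA.
have xV := subsetP BV x xB.
(* The boundary of c avoids x, so the link part is a cycle and bounds in the clique complex of the
   link. *)
have bu : bd (del x c) = 0.
  apply/eqP; rewrite -oppr_eq0 -del_bd del_eq0 //; apply: supp_sub cA _ => b bA.
  by apply: contra xA; apply: (subsetP bA).
have [b nz|v vP uv] := stellated_flag_fill (W1_link hM xV) (ltnW link_dim_gt2)
  (B := B :\ x) (n := n) _ bu.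
  have [xb [bM bB]] := supp_del cP nz; rewrite cardsU1 xb add1n => -[bn].
  rewrite -(setU1K xb); split; [exact: flag_link (setU11 _ _) bM | exact: setSD |].
  by rewrite setU1K.
have cE := bd_ins_fill uv.
have -> : bd c = bd (del x (ins x c) + v) by rewrite -cE linearD /= bd_bd addr0.
apply: (IH (B :\ x)).
- by apply: subset_trans BV; apply: subsetDl.
- move: Bk; rewrite (cardsD1 x (B :\: A)) !inE xA xB /= add1n ltnS.
  apply: leq_trans; apply/subset_leq_card/subsetP=> y; rewrite !inE.
  by case/and3P=> -> -> ->.
- apply: suppD.
    apply: supp_sub (supp_del_ins (x := x) cP) _ => a [[aM aB an] xa].
    by rewrite subsetD1 aB.
  apply: supp_sub vP _ => a [aL aB an]; split=> //.
  exact: flag_of_link xV aL.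
by rewrite -cE linearD /= bd_bd addr0.
Qed.

End MiddleDegrees.

(** * Weighted sums over subsets *)

Section Weights.

Variable T : finType.
Implicit Types (U I J B C V : {set T}) (x y : T).

(** With n the size of U, 1 / C(n, k) is n + 1 times the integral of t^k (1 - t)^(n - k) over
    [0, 1], so the sum is n + 1 times a Beta integral. The proof replaces integration by an
    induction on the points outside I and J, each put either into I or into J. *)
Lemma sum_inv_binomial U I J : I \subset U -> J \subset U -> [disjoint I & J] ->
  \sum_(B : {set T} | [&& B \subset U, I \subset B & [disjoint B & J]])
     ('C(#|U|, #|B|)%:R)^-1
  = #|U|.+1%:R * #|I|`!%:R * #|J|`!%:R / (#|I| + #|J|).+1`!%:R :> rat.
Proof.
have [k] := ubnP #|U :\: (I :|: J)|; elim: k I J => // k IH I J Uk IU JU IJ.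
have [UIJ|[u]] := set_0Vmem (U :\: (I :|: J)).
  have UE : U = I :|: J.
    apply/eqP; rewrite eqEsubset subUset IU JU andbT.
    by rewrite andbT -setD_eq0 UIJ.
  have cU : #|U| = (#|I| + #|J|)%N by rewrite UE cardsU disjoint_setI0 // cards0 subn0.
  rewrite (big_pred1 I) => [|B] /=.
    have := bin_fact (leq_addr #|J| #|I|); rewrite -cU cU addKn -cU => e.
    have nz m : m`!%:R != 0 :> rat by rewrite pnatr_eq0 -lt0n fact_gt0.
    have nzC : 'C(#|U|, #|I|)%:R != 0 :> rat.
      by rewrite pnatr_eq0 -lt0n bin_gt0 cU leq_addr.
    rewrite factS natrM -e !natrM; field.
    by rewrite nzC !nz nat1r pnatr_eq0.
  apply/and3P/eqP => [[BU IB BJ]|->]; last by split.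
  apply/eqP; rewrite eqEsubset IB andbT; apply/subsetP=> x xB.
  have := subsetP BU x xB; rewrite UE inE => /orP[//|xJ].
  by have := disjointFr BJ xB; rewrite xJ.
rewrite !inE negb_or => /andP[/andP[uI uJ] uU].
rewrite (bigID (fun B => u \in B)) /=.
have step I' J' : u |: (I :|: J) = I' :|: J' -> (#|U :\: (I' :|: J')| < k)%N.
  move=> <-; rewrite -ltnS; apply: leq_trans Uk; rewrite ltnS.
  apply: proper_card; apply/properP; split; last by exists u; rewrite !inE ?eqxx ?negb_or ?uI ?uJ.
  by apply: setDS; apply: subsetUr.
have /IH e1 : (#|U :\: ((u |: I) :|: J)| < k)%N by apply: step; rewrite setUA.
have /IH e2 : (#|U :\: (I :|: (u |: J))| < k)%N by apply: step; rewrite setUCA.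
rewrite (eq_bigl (fun B => [&& B \subset U, u |: I \subset B & [disjoint B & J]])); last first.
  by move=> B; rewrite subUset sub1set -!andbA; case: (u \in B); rewrite ?andbT ?andbF.
rewrite e1 ?subUset ?sub1set ?uU //; last first.
  by rewrite -setI_eq0 setIUl setU_eq0 !setI_eq0 IJ disjoints1 uJ.
rewrite (eq_bigl (fun B => [&& B \subset U, I \subset B & [disjoint B & u |: J]])); last first.
  move=> B; rewrite -!setI_eq0 setIUr setU_eq0 [B :&: [set u]]setIC !setI_eq0 disjoints1 -!andbA.
  by rewrite [(u \notin B) && _]andbC.
rewrite e2 ?subUset ?sub1set ?uU //; last first.
  by rewrite -setI_eq0 setIUr setU_eq0 [I :&: [set u]]setIC !setI_eq0 IJ disjoints1 uI.
rewrite !cardsU1 uI uJ !add1n addSn addnS !factS.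
have nz m : m`!%:R != 0 :> rat by rewrite pnatr_eq0 -lt0n fact_gt0.
rewrite !natrM; field.
by rewrite nz -natrD nat1r -natrD !pnatr_eq0.
Qed.

(** The weight is the probability that, in a random order of V, the points before x are exactly
    those of B; the sum is the average over all orders of a telescoping sum. *)
Lemma sum_over_flags V (h : {set T} -> rat) : (0 < #|V|)%N ->
  \sum_(x in V) \sum_(B : {set T} | B \subset V :\ x)
     (h (x |: B) - h B) / (#|V|%:R * 'C(#|V|.-1, #|B|)%:R)
  = h V - h set0.
Proof.
set n := #|V| => n0.
pose w (k : nat) : rat := (n%:R * 'C(n.-1, k)%:R)^-1.
have nn0 : n%:R != 0 :> rat by rewrite pnatr_eq0 -lt0n.
(* A set C of k points occurs as B for n - k choices of x, and as x |: B for k choices. In both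
   roles its total weight is 1 / C(n, k), so only V and the empty set survive. *)
have w_down k : (k < n)%N -> (n - k)%:R * w k = ('C(n, k)%:R)^-1.
  move=> kn; have := mul_bin_down n k; rewrite /w -natrM => ->.
  rewrite natrM invfM mulVKf // pnatr_eq0 subn_eq0 -ltnNge //.
have w_up k : (k < n)%N -> k.+1%:R * w k = ('C(n, k.+1)%:R)^-1.
  by move=> kn; have := mul_bin_diag n k; rewrite /w -natrM => ->;
  rewrite natrM invfM mulVKf // pnatr_eq0.
under eq_bigr => x _ do under eq_bigr => B _ do rewrite mulrBl -/(w _).
under eq_bigr => x _ do rewrite sumrB.
rewrite sumrB.
have -> : \sum_(x in V) \sum_(B : {set T} | B \subset V :\ x) h (x |: B) * w #|B|
        = \sum_(C : {set T} | C \subset V) h C * (C != set0)%:R / 'C(n, #|C|)%:R.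
  transitivity (\sum_(x in V) \sum_(C : {set T} | (C \subset V) && (x \in C)) h C * w #|C|.-1).
    apply: eq_bigr => x xV.
    rewrite (reindex_onto (fun C => C :\ x) (fun B => x |: B)) => [|B] /=; last first.
      by rewrite subsetD1 => /andP[_ xB]; rewrite setU1K.
    apply: congr_big => // C.
      rewrite subsetD1 setD11 andbT; have [xC|xC] := boolP (x \in C).
        by rewrite setD1K // eqxx !andbT -{2}(setD1K xC) subUset sub1set xV.
      rewrite !andbF; apply/negbTE; rewrite negb_and orbC; apply/orP; left.
      by apply: contraNneq xC => <-; rewrite setU11.
    case/andP=> _ /eqP xC; rewrite xC; congr (_ * w _).
    by rewrite -{2}xC cardsU1 setD11.
  rewrite (exchange_big_dep (fun C => C \subset V)) /= => [|x C _ /andP[] //].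
  apply: eq_bigr => C CV; rewrite (eq_bigl (mem C)) => [|x]; last first.
    by rewrite CV /= andb_idl //; apply: (subsetP CV).
  rewrite sumr_const -[_ *+ _]mulr_natl.
  have [->|C0] := eqVneq C set0; first by rewrite cards0 mul0r mulr0 mul0r.
  rewrite mulr1 -[in RHS](prednK (n := #|C|)) ?card_gt0 // -w_up.
    by rewrite prednK ?card_gt0 //; ring.
  by rewrite prednK ?card_gt0 // subset_leq_card.
have -> : \sum_(x in V) \sum_(B : {set T} | B \subset V :\ x) h B * w #|B|
        = \sum_(C : {set T} | C \subset V) h C * (C != V)%:R / 'C(n, #|C|)%:R.
  rewrite (exchange_big_dep (fun C => C \subset V)) /= => [|x C _]; last first.
    by rewrite subsetD1 => /andP[].
  apply: eq_bigr => C CV; rewrite (eq_bigl (mem (V :\: C))) => [|x]; last first.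
    by rewrite subsetD1 CV /= inE andbC.
  rewrite sumr_const cardsD (setIidPr CV) -[_ *+ _]mulr_natl.
  have [->|CnV] := eqVneq C V; first by rewrite subnn mul0r mulr0 mul0r.
  rewrite mulr1 -w_down; first by ring.
  by apply: proper_card; rewrite properEneq CnV.
rewrite -sumrB.
rewrite (bigD1 V) //= binn eqxx mulr0 mul0r subr0.
have V0 : V != set0 by rewrite -card_gt0.
rewrite (bigD1 set0) /= => [|]; last by rewrite sub0set eq_sym.
rewrite V0 (eq_sym set0) V0 eqxx cards0 bin0 /= big1 => [|C /andP[/andP[_ CnV] C0]].
  by field.
by rewrite C0 CnV subrr.
Qed.

End Weights.

(** * Ranks of graphs *)

Section Ranks.

Variables (F : fieldType) (T : finType).
Implicit Types (K L M S : {set {set T}}) (a b A B U I J : {set T}) (x y z : T).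
Notation chain := {ffun {set T} -> F^o}.
Implicit Types c u t : chain.

(** Rank and nullity for the contraction with x: the kernel holds the boundaries that avoid x, the
    image their link parts at x. *)
Lemma dim_boundaries_del K j x :
  \dim (boundaries F K j) =
  (\dim (boundaries F K j :&: lker (linfun (@del F T x)))
   + \dim (linfun (@del F T x) @: boundaries F K j))%N.
Proof. by rewrite limg_ker_dim. Qed.

Lemma memv_boundaries_ker K j x t :
  t \in (boundaries F K j :&: lker (linfun (@del F T x)))%VS <->
  t \in boundaries F K j /\ del x t = 0.
Proof. by rewrite memv_cap memv_ker lfunE /=; split=> [/andP[-> /eqP]|[-> ->]]; rewrite ?eqxx. Qed.

Lemma eq_boundaries K L j :
  (forall b, #|b| = j.+2 -> (b \in K) = (b \in L)) ->
  boundaries F K j = boundaries F L j.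
Proof.
move=> KL; apply/vspaceP=> t; apply/idP/idP => /memv_boundaries[c cP ->];
  apply/memv_boundaries; exists c => //; apply: supp_sub cP _ => b [bK bj];
  by rewrite ?KL // -KL.
Qed.

Lemma boundaries_del_eq0 K j x t : (forall b, b \in K -> x \notin b) ->
  t \in boundaries F K j -> del x t = 0.
Proof.
move=> xK /memv_boundaries[c cK ->]; rewrite del_bd del_eq0 ?linear0 ?oppr0 //.
by apply: supp_sub cK _ => a [/xK].
Qed.

Lemma in_induced K B b : (b \in induced K B) = (b \in K) && (b \subset B).
Proof. by rewrite inE. Qed.

Lemma induced_notin x K B b : x \notin B -> b \in induced K B -> x \notin b.
Proof. by move=> xB; rewrite inE => /andP[_ /subsetP bB]; apply: contra xB; apply: bB. Qed.

Lemma boundaries_induced_sub K j A B : A \subset B ->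
  (boundaries F (induced K A) j <= boundaries F (induced K B) j)%VS.
Proof.
move=> AB; apply/subvP=> t /memv_boundaries[c cP ->]; apply/memv_boundaries.
exists c => //; apply: supp_sub cP _ => a []; rewrite !inE => /andP[-> aA] ->.
by rewrite (subset_trans aA).
Qed.

Lemma elementary_neq0 a : elementary F a != 0.
Proof. by apply/eqP => /ffunP/(_ a)/eqP; rewrite !ffunE eqxx oner_eq0. Qed.

(** The dimension of the 0-boundaries is the number of edges of a spanning forest. A new vertex
    whose neighbours form a clique merges no components, so it adds one edge exactly when it has a
    neighbour. *)
Lemma rank_cone S x B : x \notin B ->
  (forall y z, y \in B -> z \in B -> [set x; y] \in S -> [set x; z] \in S ->
     y != z -> [set y; z] \in S) ->
  \dim (boundaries F (induced S (x |: B)) 0) =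
  (\dim (boundaries F (induced S B) 0) + [exists y in B, [set x; y] \in S])%N.
Proof.
move=> xB clique; rewrite (dim_boundaries_del _ _ x).
pose N := [set y in B | [set x; y] \in S].
have uN c : supp (fun a => a \in induced S (x |: B) /\ #|a| = 2) c ->
    supp (fun b => b \subset N /\ #|b| = 1%N) (del x c).
  move=> cP; apply: supp_sub (supp_del (x := x) cP) _ => b [xb []].
  rewrite cardsU1 xb add1n => + [b1]; move/eqP/cards1P: (b1) => [y by'].
  rewrite by' in b1 xb *; rewrite b1 !inE sub1set inE => /andP[-> /subsetP/(_ y)].
  rewrite !inE eqxx orbT => /(_ isT)/orP[/eqP yx|-> //].
  by rewrite yx set11 in xb.
congr (_ + _)%N; last first.
  have [/existsP[y /andP[yB xyS]]|nN] := boolP [exists y in B, [set x; y] \in S].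
    suff -> : (linfun (@del F T x) @: boundaries F (induced S (x |: B)) 0)%VS
             = <[elementary F set0]>%VS by rewrite dim_vline elementary_neq0.
    apply/vspaceP=> t; apply/idP/vlineP => [/memv_imgP[_ /memv_boundaries[c cP ->] ->]|[k ->]].
      rewrite lfunE /= del_bd; exists (- bd (del x c) set0).
      apply/ffunP=> b; rewrite !ffunE; case: eqP => [->|b0]; first by rewrite [RHS]mulr1.
      rewrite scaler0; apply/eqP; rewrite oppr_eq0; apply/negPn/negP.
      move=> /(supp_bd (uN _ cP))[z zb []]; rewrite cardsU1 zb add1n => _ [] /eqP.
      by rewrite cards_eq0 => /eqP.
    apply: memvZ; have xy : x != y by apply: contraNneq xB => ->.
    have ex : supp (fun a => a = [set y]) (elementary F [set y]) by apply: supp_elementary.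
    apply/memv_imgP; exists (bd (- ins x (elementary F [set y]))).
      apply/memv_boundaries; exists (- ins x (elementary F [set y])) => //.
      apply: suppN; apply: supp_sub (supp_ins (x := x) ex) _ => a [xa ay].
      rewrite -(setD1K xa) ay cards2 xy; split=> //.
      by rewrite inE xyS subUset !sub1set !inE eqxx yB orbT.
    rewrite lfunE /= del_bd !linearN /= opprK del_ins ?bd_vertex // => a nz.
    by rewrite (ex a nz) inE.
  apply/eqP; rewrite dimv_eq0 -subv0; apply/subvP=> t.
  case/memv_imgP=> _ /memv_boundaries[c cP ->] ->; rewrite lfunE /= del_bd.
  suff -> : del x c = 0 by rewrite linear0 oppr0 mem0v.
  apply/ffunP=> b; rewrite [RHS]ffunE; apply/eqP/negPn/negP => /(uN _ cP)[bN].
  move/eqP/cards1P=> [y by']; case/negP: nN; apply/existsP; exists y.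
  by move: bN; rewrite by' sub1set inE.
congr (\dim _); apply/vspaceP=> t; apply/idP/idP; last first.
  move=> tB; apply/memv_boundaries_ker; split.
    by apply: subvP tB; apply/boundaries_induced_sub/subsetUr.
  by apply: boundaries_del_eq0 tB => b; apply: induced_notin.
case/memv_boundaries_ker=> /memv_boundaries[c cP ->] rc.
have [|v vP uv] := simplex_fill (uN _ cP).
  by apply/eqP; rewrite -oppr_eq0 -del_bd rc.
have cE := bd_ins_fill uv; apply/memv_boundaries; exists (del x (ins x c) + v).
  apply: suppD.
    apply: supp_sub (supp_del_ins (x := x) cP) _ => a [[]]; rewrite !inE.
    by move=> /andP[-> aB] -> xa; rewrite (subset_setU1 aB xa).
  apply: supp_sub vP _ => b [bN b2]; split=> //; rewrite inE.
  move: bN; have /eqP/cards2P[y [z [yz ->]]] := b2; rewrite subUset !sub1set !inE.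
  by case/andP=> /andP[yB xy] /andP[zB xz]; rewrite clique // subUset !sub1set yB zB.
by rewrite -cE linearD /= bd_bd addr0.
Qed.

Lemma rank_complete S A :
  (forall x y, x \in A -> y \in A -> x != y -> [set x; y] \in S) ->
  \dim (boundaries F (induced S A) 0) = #|A|.-1.
Proof.
have [n] := ubnP #|A|; elim: n A => // n IH A An completeA.
have [->|[x xA]] := set_0Vmem A.
  rewrite cards0; apply/eqP; rewrite dimv_eq0 -subv0; apply/subvP=> t.
  case/memv_boundaries=> c cP ->; suff -> : c = 0 by rewrite linear0 mem0v.
  apply/ffunP=> b; rewrite ffunE; apply/eqP/negPn/negP => /cP[].
  by rewrite inE subset0 => /andP[_ /eqP ->]; rewrite cards0.
have Ax : (#|A :\ x| < n)%N by move: An; rewrite (cardsD1 x) xA.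
rewrite -{1}(setD1K xA) rank_cone ?setD11 //; last first.
  by move=> y z /setD1P[_ yA] /setD1P[_ zA] _ _; apply: completeA.
rewrite IH // => [|y z /setD1P[_ yA] /setD1P[_ zA]]; last exact: completeA.
rewrite (cardsD1 x A) xA add1n /=; have [A0|[y yA]] := set_0Vmem (A :\ x).
  rewrite A0 cards0 /=; apply/eqP; rewrite eqb0; apply/existsP=> -[y].
  by rewrite inE.
have -> : [exists y in A :\ x, [set x; y] \in S].
  apply/existsP; exists y; rewrite yA; case/setD1P: yA => yx yA.
  by rewrite completeA // eq_sym.
by rewrite addn1 prednK // card_gt0; apply/set0Pn; exists y.
Qed.

Lemma rank_move1 K a x B : simplicial_complex K -> facet K a -> #|a| = 3 ->
  x \notin vertices K ->
  \dim (boundaries F (induced (move1 K a x) B) 0) =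
  (\dim (boundaries F (induced K B) 0) + ((x \in B) && ~~ [disjoint B & a]))%N.
Proof.
move=> cK fa a3 xK; have aK := facet_mem fa; have xa := notin_face cK xK aK.
have old b : x \notin b -> #|b| = 2 -> (b \in move1 K a x) = (b \in K).
  move=> xb b2; rewrite move1_notin // andb_idr // => _.
  by apply/eqP=> ba; rewrite ba a3 in b2.
have [xB|xB] := boolP (x \in B); last first.
  rewrite addn0; congr (\dim _); apply: eq_boundaries => b b2; rewrite !in_induced.
  have [bB|] := boolP (b \subset B); rewrite ?andbF // !andbT.
  by apply: old => //; apply: contra xB; apply: (subsetP bB).
have new y : y != x -> ([set x; y] \in move1 K a x) = (y \in a).
  move=> yx; have xy : x \notin [set y] by rewrite inE eq_sym.
  rewrite move1_in //.
  by rewrite properEcard sub1set cards1 a3 andbT.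
rewrite -{1}(setD1K xB) rank_cone ?setD11 // => [|y z].
  congr (_ + _)%N.
    congr (\dim _); apply: eq_boundaries => b b2; rewrite !in_induced subsetD1.
    have [xb|xb] := boolP (x \in b).
      rewrite !andbF; apply/esym/negbTE; apply: contraTN xb => /andP[bK _].
      exact: notin_face cK xK bK.
    by rewrite old // andbT.
  congr (nat_of_bool _); apply/existsP/idP => [[y /andP[/setD1P[yx yB]]]|].
    rewrite new // => ya; apply/negP=> /disjointFr/(_ yB).
    by rewrite ya.
  rewrite -setI_eq0 => /set0Pn[y /setIP[yB ya]]; exists y.
  have yx : y != x by apply: contraNneq xa => <-.
  by rewrite new // !inE yx yB ya.
case/setD1P=> yx yB /setD1P[zx zB]; rewrite !new // => ya za yz.
have xyz : x \notin [set y; z] by rewrite !inE negb_or ![x == _]eq_sym yx.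
by rewrite old ?cards2 ?yz //; apply: (proj2 cK) aK _; rewrite subUset !sub1set ya.
Qed.

Lemma sum_indicator U I J : I \subset U -> J \subset U -> [disjoint I & J] ->
  \sum_(B : {set T} | B \subset U)
     ((I \subset B) && [disjoint B & J])%:R / 'C(#|U|, #|B|)%:R
  = #|U|.+1%:R * #|I|`!%:R * #|J|`!%:R / (#|I| + #|J|).+1`!%:R :> rat.
Proof.
move=> IU JU IJ; rewrite -sum_inv_binomial // big_mkcondr; apply: eq_bigr => B _.
by case: ifP; rewrite ?mul1r ?mul0r.
Qed.

Lemma disjoint_set0 B : [disjoint B & (@set0 T)].
Proof. by rewrite -setI_eq0 setI0. Qed.

Lemma sum_indicator0 U :
  \sum_(B : {set T} | B \subset U) 1 / 'C(#|U|, #|B|)%:R = #|U|.+1%:R :> rat.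
Proof.
have := sum_indicator (sub0set U) (sub0set U) (disjoint_set0 _).
rewrite cards0 fact0 (_ : (0 + 0).+1`! = 1%N) // !mulr1 ?divr1 => <-; apply: eq_bigr => B _.
by rewrite sub0set disjoint_set0.
Qed.

Lemma sum_indicator1 U x : x \in U ->
  \sum_(B : {set T} | B \subset U) (x \in B)%:R / 'C(#|U|, #|B|)%:R
  = #|U|.+1%:R / 2 :> rat.
Proof.
rewrite -sub1set => xU; have := sum_indicator xU (sub0set U) (disjoint_set0 _).
rewrite cards0 cards1 fact0 (_ : 1`! = 1%N) // (_ : (1 + 0).+1`! = 2%N) //.
rewrite !mulr1 => <-; apply: eq_bigr => B _.
by rewrite sub1set disjoint_set0 andbT.
Qed.

(* The numerical heart of the case d = 3: the weighted number of edges of a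
   spanning forest over all induced subgraphs of a stacked 2-sphere depends
   on its number of vertices only. *)
Lemma sum_rank_stellated L U : stellated1_sphere 2 L -> vertices L \subset U ->
  \sum_(B : {set T} | B \subset U)
    (\dim (boundaries F (induced L B) 0))%:R / 'C(#|U|, #|B|)%:R
  = #|U|.+1%:R * (9 * #|vertices L|%:R - 12) / 20 :> rat.
Proof.
suff H e L' : stellated1_sphere e L' -> e = 2%N -> vertices L' \subset U ->
    \sum_(B : {set T} | B \subset U)
      (\dim (boundaries F (induced L' B) 0))%:R / 'C(#|U|, #|B|)%:R
    = #|U|.+1%:R * (9 * #|vertices L'|%:R - 12) / 20 :> rat.
  by move=> sL; apply: H sL _.
move: e L'; apply: stellated_ind => [e a ae e2|e K a x _ cK fa ae xK IH e2].
  rewrite e2 in ae; have -> : vertices (bd_simplex a) = a.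
    apply/setP=> y; rewrite !inE properEcard sub1set cards1 ae andbT //.
  move=> aU.
  have rk B : (\dim (boundaries F (induced (bd_simplex a) B) 0))%:R
     = \sum_(y in a) (y \in B)%:R - 1 + [disjoint B & a]%:R :> rat.
    rewrite (@eq_boundaries _ (induced (bd_simplex a) (B :&: a))) => [|b b2]; last first.
      rewrite !inE subsetI; case: (boolP (b \proper a)) => //= /proper_sub ->.
      by rewrite andbT.
    rewrite rank_complete => [|y z /setIP[_ ya] /setIP[_ za] yz]; last first.
      by rewrite inE properEcard subUset !sub1set ya za cards2 yz ae.
    have -> : \sum_(y in a) (y \in B)%:R = #|B :&: a|%:R :> rat.
      rewrite -sum1_card natr_sum big_mkcond [RHS]big_mkcond; apply: eq_bigr => y _.
      by rewrite inE; case: (y \in a); case: (y \in B).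
    rewrite -setI_eq0 -cards_eq0; case: #|B :&: a| => [|k]; first by rewrite /= sub0r addNr.
    by rewrite /= addr0 -natr1 addrK.
  under eq_bigr => B _ do rewrite rk mulrDl mulrBl mulr_suml.
  rewrite big_split sumrB exchange_big /=.
  rewrite (eq_bigr (fun=> #|U|.+1%:R / 2)) => [|y ya]; last first.
    exact/sum_indicator1/(subsetP aU).
  rewrite sum_indicator0 sumr_const ae -[_ *+ _]mulr_natl.
  have aE : \sum_(B : {set T} | B \subset U) [disjoint B & a]%:R / 'C(#|U|, #|B|)%:R
            = #|U|.+1%:R / 5 :> rat.
    have := sum_indicator (sub0set U) aU; rewrite disjoint_sym disjoint_set0 cards0 ae.
    move=> /(_ isT) e5; transitivity (#|U|.+1%:R * 0`!%:R * 4`!%:R / (0 + 4).+1`!%:R : rat).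
      by rewrite -e5; apply: eq_bigr => B _; rewrite sub0set.
    by rewrite !factS fact0; field.
  by rewrite aE; field.
rewrite e2 in ae IH *; move=> VU.
have xV : x |: vertices K \subset U by rewrite -(vertices_move1 cK fa xK) ?ae.
have [xU KU] : x \in U /\ vertices K \subset U.
  by move: xV; rewrite subUset sub1set => /andP[].
have aU : a \subset U.
  by apply: subset_trans KU; apply/subsetP=> y; apply: vertices_mem cK (facet_mem fa).
have xa := notin_face cK xK (facet_mem fa).
rewrite vertices_move1 ?ae // cardsU1 xK add1n.
under eq_bigr => B _ do rewrite rank_move1 // natrD mulrDl.
rewrite big_split /= IH //.
have -> : \sum_(B : {set T} | B \subset U)
    ((x \in B) && ~~ [disjoint B & a])%:R / 'C(#|U|, #|B|)%:R
    = \sum_(B : {set T} | B \subset U) (x \in B)%:R / 'C(#|U|, #|B|)%:R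
      - \sum_(B : {set T} | B \subset U)
          (([set x] \subset B) && [disjoint B & a])%:R / 'C(#|U|, #|B|)%:R :> rat.
  rewrite -sumrB; apply: eq_bigr => B _; rewrite sub1set -mulrBl.
  by case: (x \in B); case: [disjoint B & a]; rewrite ?subrr ?subr0.
rewrite sum_indicator1 // sum_indicator ?sub1set ?disjoints1 // cards1 ae.
by rewrite -natr1 !factS fact0; field.
Qed.

End Ranks.

(** * Dimension three *)

Section Betti1.

Variables (F : fieldType) (T : finType).
Implicit Types (K L M S : {set {set T}}) (a b A B : {set T}) (x y z : T).
Notation chain := {ffun {set T} -> F^o}.

Lemma dim_chains K j : \dim (chains F K j) = #|[set a in K | #|a| == j.+1]|.
Proof.
set s := [seq a : {set T} <- enum K | #|a| == j.+1]; pose e := [seq elementary F a | a <- s].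
have us : uniq s by rewrite filter_uniq ?enum_uniq.
have -> : #|[set a in K | #|a| == j.+1]| = size e.
  rewrite size_map -(card_uniqP us); apply: eq_card => a.
  by rewrite !inE mem_filter mem_enum andbC.
apply/eqP; change (free (in_tuple e)); apply/freeP => k ke i.
have is_ : (i < size s)%N by have := ltn_ord i; rewrite [X in (_ < X)%N](size_map).
have /ffunP/(_ (nth set0 s i)) := ke; rewrite sum_ffunE (bigD1 i) //= big1 => [|l li].
  rewrite !ffunE (nth_map set0) // addr0 ffunE eqxx => <-.
  by rewrite [RHS]mulr1.
have ls : (l < size s)%N by have := ltn_ord l; rewrite [X in (_ < X)%N](size_map).
rewrite ffunE (nth_map set0) // ffunE nth_uniq // eq_sym (inj_eq val_inj) (negbTE li).
by rewrite scaler0.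
Qed.

Lemma dim_cycles_boundaries K j :
  (\dim (cycles F K j.+1) + \dim (boundaries F K j) = \dim (chains F K j.+1))%N.
Proof. by rewrite limg_ker_dim. Qed.

Lemma betti1_two_neighbourly M : simplicial_complex M -> two_neighbourly M ->
  (betti F M 1 + \dim (boundaries F M 1) + #|vertices M|.-1)%N = 'C(#|vertices M|, 2).
Proof.
move=> cM M2; rewrite /betti subnK; last exact/dimvS/boundaries_sub_cycles.
have indM : induced M (vertices M) = M.
  apply/setP=> a; rewrite inE andb_idr // => aM.
  by apply/subsetP=> x; apply: vertices_mem.
rewrite -(@rank_complete F T M) // indM dim_cycles_boundaries dim_chains.
rewrite -cards_draws; apply: eq_card => a; rewrite !inE.
have [a2|] := boolP (#|a| == 2); rewrite ?andbF // !andbT.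
apply/idP/idP => [aM|]; first by apply/subsetP=> x; apply: vertices_mem aM.
move/cards2P: a2 => [x [y [xy ->]]]; rewrite subUset !sub1set => /andP[xV yV].
exact: M2.
Qed.

End Betti1.

Section DimensionThree.

Variables (F : fieldType) (T : finType) (M : {set {set T}}).
Hypotheses (hM : W1 3 M) (M2 : two_neighbourly M).
Implicit Types (a b A B : {set T}) (x y : T).
Notation chain := {ffun {set T} -> F^o}.

Let V := vertices M.
Let delF x := linfun (@del F T x).

Lemma link_boundaries x B : x \notin B ->
  (delF x @: boundaries F (induced M (x |: B)) 1)%VS
  = boundaries F (induced (link x M) B) 0.
Proof.
move=> xB; apply/vspaceP=> t; apply/idP/idP.
  case/memv_imgP=> _ /memv_boundaries[c cP ->] ->; rewrite lfunE /= del_bd -linearN.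
  apply/memv_boundaries; exists (- del x c) => //; apply: suppN => b nz.
  have cM : supp (fun a => a \in M /\ #|a| = 3) c.
    by apply: supp_sub cP _ => a []; rewrite inE => /andP[].
  have [bL b2] := supp_del_link hM cM nz; split=> //; rewrite inE bL.
  have [xb []] := supp_del cP nz; rewrite inE => /andP[_ bB] _ /=.
  by apply: subset_setU1 xb; apply: subset_trans bB; apply: subsetUr.
case/memv_boundaries=> c cP ->; apply/memv_imgP.
have cL : supp (fun b => b \in link x M /\ #|b| = 2) c.
  by apply: supp_sub cP _ => a []; rewrite inE => /andP[].
exists (bd (- ins x c)).
  apply/memv_boundaries; exists (- ins x c) => //; apply: suppN => a nz.
  have [aM a3] := supp_ins_link cL nz; split=> //; rewrite inE aM.
  have [xa []] := supp_ins cP nz; rewrite inE => /andP[_ aB] _ /=.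
  by rewrite -(setD1K xa) setUS.
rewrite lfunE /= del_bd !linearN /= opprK del_ins //.
exact: supp_notin_link cL.
Qed.

(* dim ker (H_1(M[B]) -> H_1(M[B + x])) *)
Definition killed x B : nat :=
  (\dim (boundaries F (induced M (x |: B)) 1 :&: lker (delF x))%VS
   - \dim (boundaries F (induced M B) 1))%N.

Lemma boundaries_sub_ker x B : x \notin B ->
  (boundaries F (induced M B) 1
     <= boundaries F (induced M (x |: B)) 1 :&: lker (delF x))%VS.
Proof.
move=> xB; apply/subvP=> t tB; apply/memv_boundaries_ker; split.
  by apply: subvP tB; apply/boundaries_induced_sub/subsetUr.
by apply: boundaries_del_eq0 tB => b; apply: induced_notin.
Qed.

Lemma dim_boundaries1_setU1 x B : x \notin B ->
  \dim (boundaries F (induced M (x |: B)) 1) =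
  (\dim (boundaries F (induced M B) 1) + killed x B
   + \dim (boundaries F (induced (link x M) B) 0))%N.
Proof.
move=> xB; rewrite (dim_boundaries_del F _ _ x) link_boundaries //.
by rewrite /killed subnKC // dimvS // boundaries_sub_ker.
Qed.

Lemma killed_eq0 x B : x \notin B -> killed x B = 0 ->
  (boundaries F (induced M (x |: B)) 1 :&: lker (delF x))%VS
  = boundaries F (induced M B) 1.
Proof.
move=> xB /eqP; rewrite subn_eq0 => dle; apply/eqP; rewrite eq_sym eqEdim dle andbT.
exact: boundaries_sub_ker.
Qed.

Lemma refillable_killed x B : x \notin B -> refillable F M 1 B -> killed x B = 0.
Proof.
move=> xB fillB; apply/eqP; rewrite subn_eq0; apply: dimvS; apply/subvP=> t.
case/memv_boundaries_ker=> /memv_boundaries[c cP ->] rc.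
have cM : supp (fun a => a \in M /\ #|a| = 3) c.
  by apply: supp_sub cP _ => a []; rewrite inE => /andP[].
apply/memv_boundaries; apply: fillB => // b nz.
have [y _ []] := supp_bd cP nz; rewrite inE => /andP[_ /(subset_trans (subsetUr _ _)) bB] _.
by apply: subset_setU1 bB _; apply: del0_supp rc _ nz.
Qed.

Lemma killed_refillable A : A \subset V ->
  (forall x B, x \in V -> B \subset V :\ x -> killed x B = 0) -> refillable F M 1 A.
Proof.
move=> AV kill0 c cM cA; apply/memv_boundaries.
suff H (k : nat) B t : A \subset B -> B \subset V -> (#|B :\: A| <= k)%N ->
    t \in boundaries F (induced M B) 1 -> supp (fun b => b \subset A) t ->
    t \in boundaries F (induced M A) 1.
  apply: (H _ V) (leqnn _) _ cA => //; apply/memv_boundaries; exists c => //.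
  move=> a /cM[aM ->]; rewrite inE aM; split=> //.
  by apply/subsetP=> x; apply: vertices_mem (W1_complex hM) aM.
elim: k B t => [|k IH] B t AB BV.
  rewrite leqn0 cards_eq0 setD_eq0 => BA; suff -> : A = B by [].
  by apply/eqP; rewrite eqEsubset AB.
have [BA _ tB _|/subsetPn[x xB xA] Bk tB tA] := boolP (B \subset A).
  by suff -> : A = B by []; apply/eqP; rewrite eqEsubset AB.
apply: (IH (B :\ x)) => //.
- by rewrite subsetD1 AB.
- by apply: subset_trans BV; apply: subsetDl.
- move: Bk; rewrite (cardsD1 x (B :\: A)) !inE xA xB /= add1n ltnS.
  apply: leq_trans; apply/subset_leq_card/subsetP=> y; rewrite !inE.
  by case/and3P=> -> -> ->.
rewrite -(@killed_eq0 x) ?setD11 ?kill0 ?(subsetP BV) ?setSD //.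
apply/memv_boundaries_ker; rewrite setD1K //; split=> //.
by apply: del_eq0; apply: supp_sub tA _ => b bA; apply: contra xA; apply: (subsetP bA).
Qed.

Lemma vertices_link x : x \in V -> vertices (link x M) = V :\ x.
Proof.
move=> xV; apply/setP=> y; rewrite !inE andbA [x == y]eq_sym.
have [->|yx] := eqVneq y x; rewrite ?andbF //=.
rewrite andbT andb_idr // => yV; apply: M2; rewrite ?inE 1?eq_sym //.
by move: xV; rewrite inE.
Qed.

Let n : rat := #|V|%:R.

Lemma card_vertices_gt0 : (0 < #|V|)%N.
Proof. by have [x xV] := W1_vertex hM; rewrite card_gt0; apply/set0Pn; exists x. Qed.

Lemma betti1_killed :
  (betti F M 1)%:R = (n - 4) * (n - 5) / 20
    - \sum_(x in V) \sum_(B : {set T} | B \subset V :\ x)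
         (killed x B)%:R / (n * 'C(#|V|.-1, #|B|)%:R) :> rat.
Proof.
have n0 := card_vertices_gt0; have cM := W1_complex hM.
have nn0 : n != 0 by rewrite pnatr_eq0 -lt0n.
have indM : induced M V = M.
  apply/setP=> a; rewrite inE andb_idr // => aM.
  by apply/subsetP=> x; apply: vertices_mem.
pose b B : rat := (\dim (boundaries F (induced M B) 1))%:R.
have b0 : b set0 = 0.
  rewrite /b (_ : boundaries _ _ _ = 0%VS) ?dimv0 //; apply/eqP; rewrite -subv0.
  apply/subvP=> t /memv_boundaries[c cP ->]; suff -> : c = 0 by rewrite linear0 mem0v.
  apply/ffunP=> a; rewrite [RHS]ffunE; apply/eqP/negPn/negP => /cP[].
  by rewrite inE subset0 => /andP[_ /eqP ->]; rewrite cards0.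
have bE x B : x \notin B -> b (x |: B) - b B
    = (killed x B)%:R + (\dim (boundaries F (induced (link x M) B) 0))%:R.
  by move=> xB; rewrite /b dim_boundaries1_setU1 // !natrD; ring.
have := sum_over_flags b n0; rewrite b0 subr0.
under eq_bigr => x xV.
  under eq_bigr => B BVx.
    have xB : x \notin B by apply: contraTN BVx => xB; apply/subsetPn; exists x; rewrite ?setD11.
    rewrite bE // mulrDl.
    over.
  rewrite big_split /=.
  over.
rewrite big_split /= -/n.
set R := \sum_(x in V) \sum_(B | _) _.
have -> : \sum_(x in V) \sum_(B : {set T} | B \subset V :\ x)
    (\dim (boundaries F (induced (link x M) B) 0))%:R / (n * 'C(#|V|.-1, #|B|)%:R)
    = n * (9 * n - 21) / 20 :> rat.
  rewrite (eq_bigr (fun=> (9 * n - 21) / 20)) => [|x xV].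
    by rewrite sumr_const -[_ *+ _]mulr_natl mulrA.
  have Vx : #|V|.-1 = #|V :\ x| by rewrite (cardsD1 x V) xV.
  have n1 : #|V :\ x|%:R = n - 1 by rewrite /n (cardsD1 x V) xV add1n -natr1 addrK.
  transitivity (n^-1 * (#|V :\ x|.+1%:R * (9 * #|vertices (link x M)|%:R - 12) / 20) : rat).
    rewrite -(sum_rank_stellated F (W1_link hM xV)) ?vertices_link // mulr_sumr.
    by apply: eq_bigr => B _; rewrite Vx invfM; ring.
  by rewrite vertices_link // -natr1 n1; field.
move=> bV; have := betti1_two_neighbourly F cM M2.
move/(congr1 (fun m => m%:R : rat)); rewrite !natrD.
have <- : b V = (\dim (boundaries F M 1))%:R by rewrite /b indM.
rewrite -bV.
have nE : #|V|.-1%:R = n - 1 by rewrite /n -{2}(prednK n0) -natr1 addrK.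
rewrite nE; have -> : 'C(#|V|, 2)%:R = n * (n - 1) / 2.
  have := mul_bin_diag #|V| 1; rewrite bin1 => /(congr1 (fun m => m%:R : rat)).
  by rewrite !natrM nE -/n => ->; field.
move=> e; apply: (addIr (R + n * (9 * n - 21) / 20 + (n - 1))).
by rewrite addrA e; field.
Qed.

Lemma refillable1_iff_betti1 :
  (forall A, A \subset V -> refillable F M 1 A)
  <-> (betti F M 1)%:R = (n - 4) * (n - 5) / 20 :> rat.
Proof.
rewrite betti1_killed; set R := (X in _ - X); have n0 := card_vertices_gt0.
have nn0 : 0 < n by rewrite ltr0n.
have term_ge0 x B : 0 <= (killed x B)%:R / (n * 'C(#|V|.-1, #|B|)%:R).
  by rewrite divr_ge0 ?mulr_ge0 ?ler0n.
split=> [fillM|R0 A AV].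
  rewrite [R]big1 ?subr0 // => x xV; rewrite big1 // => B BVx.
  rewrite refillable_killed ?mul0r //.
    by move: BVx; rewrite subsetD1 => /andP[].
  by apply: fillM; apply: subset_trans BVx _; apply: subsetDl.
have {}R0 : R == 0.
  by rewrite -oppr_eq0; apply/eqP/(addrI ((n - 4) * (n - 5) / 20)); rewrite R0 addr0.
apply: killed_refillable AV _ => x B xV BVx; apply/eqP.
move: R0; rewrite psumr_eq0 => [|y _]; last by apply: sumr_ge0.
move/allP/(_ x (mem_index_enum _)); rewrite xV /= psumr_eq0 //.
have Bn : (#|B| <= #|V|.-1)%N by rewrite (cardsD1 x V) xV /= subset_leq_card.
have den0 : n * 'C(#|V|.-1, #|B|)%:R != 0.
  by rewrite mulf_neq0 ?gt_eqF // ltr0n bin_gt0.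
move/allP/(_ B (mem_index_enum _)); rewrite BVx /= mulf_eq0 invr_eq0.
by rewrite (negbTE den0) orbF pnatr_eq0.
Qed.

End DimensionThree.

Theorem proposition5p8 (F : fieldType) (T : finType) (d : nat)
    (M : {set {set T}}) (hM : W1 d M) :
  (d <> 3%N ->
     (tight F d M <-> two_neighbourly M /\ orientable F d M)) /\
  (d = 3%N ->
     (tight F d M <->
        [/\ two_neighbourly M, orientable F d M
          & let n : rat := #|vertices M|%:R in
            (betti F M 1)%:R = (n - 4) * (n - 5) / 20])).
Proof.
have tightI : two_neighbourly M -> orientable F d M ->
    (forall (A : {set T}) j, A \subset vertices M -> (0 < j)%N ->
       (j.+2 <= d)%N -> refillable F M j A) ->
    tight F d M.
  move=> M2 oM mid; split; [by case: hM | by case: hM | move=> A AV j jd].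
  apply: refillable_injective => //.
  have [->|j0] := posnP j; first exact: refillable0.
  move: jd; rewrite leq_eqVlt => /orP[/eqP -> |jd]; first exact: (refillable_top hM).
  move: (jd); rewrite leq_eqVlt => /orP[/eqP jd1|]; last exact: mid.
  have -> : j = d.-1 by rewrite -jd1.
  exact: refillable_codim1.
split=> [d3|d3].
  split=> [tM|[M2 oM]].
    by split; [exact: tight_two_neighbourly tM | exact: tight_orientable tM].
  apply: tightI => // A j _ j0 jd; have d4 : (3 < d)%N by lia.
  exact: (refillable_middle hM d4).
subst d; split=> [tM|[M2 oM bM]].
  have M2 := tight_two_neighbourly tM; have oM := tight_orientable hM tM.
  split=> //; apply/(refillable1_iff_betti1 F hM M2) => A AV.
  apply: (injective_refillable hM) => //; case: tM => _ _ tM; exact: tM.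
apply: tightI => // A j AV j0 j3; have -> : j = 1%N by lia.
by have /(refillable1_iff_betti1 F hM M2) := bM; apply.
Qed.
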